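(* Suppose that assumptions AS.1, AS.2 and AS.5 (stated in the context) hold, and consider SQN in which the directions $H_kg_k$ are computed by the stochastic damped L-BFGS procedure (SdLBFGS) described in the context, with memory size $p$ and parameter $\delta>0$; let $\underline{\kappa},\bar{\kappa}>0$ be the bounds on $H_k$ given in the context. Let $\tilde D>0$ be a (problem-independent) constant, $D_f:=f(x_1)-f^{low}$, and $$C_1=\frac{4\sigma\bar{\kappa}^2D_f}{\underline{\kappa}^2\sqrt{\tilde D}}+\sigma L\sqrt{\tilde D},\qquad C_2=\frac{4L\bar{\kappa}^2D_f}{\underline{\kappa}^2}.$$ Let $\epsilon>0$, let $\bar N$ be the number of oracle calls used to calculate the stochastic gradients $g_k$, satisfying $$\bar N\ge\max\left\{\frac{C_1^2}{\epsilon^2}+\frac{4C_2}{\epsilon},\ \frac{\sigma^2}{L^2\tilde D}\right\},$$ let $$m_k=m:=\left\lceil\min\left\{\bar N,\max\left\{1,\frac{\sigma}{L}\sqrt{\frac{\bar N}{\tilde D}}\right\}\right\}\right\rceil,$$ let the number of iterations be $N=\lceil\bar N/m\rceil$, let $\alpha_k=\underline{\kappa}/(L\bar{\kappa}^2)$ for $k=1,\ldots,N$, and let $R$ be a random variable, independent of the samples, with $$\mathrm{Prob}\{R=k\}=\frac{\alpha_k\underline{\kappa}-\alpha_k^2L\bar{\kappa}^2/2}{\sum_{j=1}^N\left(\alpha_j\underline{\kappa}-\alpha_j^2L\bar{\kappa}^2/2\right)},\qquad k=1,\ldots,N.$$ Let $N_{sfo}$ denote the total number of oracle calls in this method, including those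 used to form the vectors $y_{k-1}$. Then to achieve $\mathbb{E}[\|\nabla f(x_R)\|^2]\le\epsilon$ one has $N_{sfo}\le2\bar N$, where $\bar N$ satisfies $\bar N\ge\max\left\{\frac{C_1^2}{\epsilon^2}+\frac{4C_2}{\epsilon},\ \frac{\sigma^2}{L^2\tilde D}\right\}$, i.e. is $O(\epsilon^{-2})$.
   Context: Setting. $f(x)=\mathbb{E}[F(x,\xi)]$ for $x\in\mathbb{R}^n$, where $F:\mathbb{R}^n\times\mathbb{R}^d\to\mathbb{R}$ is possibly nonconvex and $\xi$ is a random vector in $\mathbb{R}^d$. A stochastic first-order oracle returns, for given $x$ and a sample $\xi$, a stochastic gradient $g(x,\xi)\in\mathbb{R}^n$; each such evaluation is one oracle call. $\|\cdot\|$ is the Euclidean norm (operator norm for matrices); $A\preceq B$ means $B-A$ is positive semidefinite. SQN iteration. Given $x_1\in\mathbb{R}^n$, a positive definite $H_1$, batch sizes $m_k$ and step sizes $\alpha_k>0$. For $k=1,2,\ldots$: draw samples $\xi_k=(\xi_{k,1},\ldots,\xi_{k,m_k})$, set $g_k=\frac1{m_k}\sum_{i=1}^{m_k}g(x_k,\xi_{k,i})$, generate a positive definite $H_k$, and set $x_{k+1}=x_k-\alpha_kH_kg_k$. Write $\xi_{[k]}=(\xi_1,\ldots,\xi_k)$; expectations of $x_R$ are over $R$ and $\xi_{[N]}$. SdLBFGS. For $k\ge2$ put $s_{k-1}=x_k-x_{k-1}$ and $y_{k-1}=\frac1{m_{k-1}}\sum_{i=1}^{m_{k-1}}\big(g(x_k,\xi_{k-1,i})-g(x_{k-1},\xi_{k-1,i})\big)$,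 which requires $m_{k-1}$ additional oracle calls (for the values $g(x_k,\xi_{k-1,i})$) at iteration $k$. Put $H_{k,0}=\gamma_k^{-1}I$ with $\gamma_k=\max\{y_{k-1}^\top y_{k-1}/(s_{k-1}^\top y_{k-1}),\delta\}$, $\delta>0$ a given constant; $\bar y_{k-1}=\theta_{k-1}y_{k-1}+(1-\theta_{k-1})H_{k,0}^{-1}s_{k-1}$, where $\theta_{k-1}=\frac{0.75\,s_{k-1}^\top H_{k,0}^{-1}s_{k-1}}{s_{k-1}^\top H_{k,0}^{-1}s_{k-1}-s_{k-1}^\top y_{k-1}}$ if $s_{k-1}^\top y_{k-1}<0.25\,s_{k-1}^\top H_{k,0}^{-1}s_{k-1}$ and $\theta_{k-1}=1$ otherwise; $\rho_j=(s_j^\top\bar y_j)^{-1}$. With memory size $p\ge1$, $$H_{k,i}=(I-\rho_js_j\bar y_j^\top)H_{k,i-1}(I-\rho_j\bar y_js_j^\top)+\rho_js_js_j^\top,\quad j=k-(p-i+1),\ i=1,\ldots,p,$$ and $H_k=H_{k,p}$; when fewer than $p$ past pairs $(s_j,\bar y_j)$ are available, all available pairs are used in order. All quantities are assumed well defined ($s_j\ne0$, $s_j^\top y_j\neq 0$). Assumptions. AS.1: $f$ is continuously differentiable, $f(x)\ge f^{low}$ for all $x$, and $\|\nabla f(x)-\nabla f(y)\|\le L\|x-y\|$ for all $x,y$. AS.2: all samples are independent, the samples of iteration $k$ are independent of $\{x_j\}_{j=1}^k$, and for each $k$ and each sample $\xi$ of iteration $k$ (expectation over that sample) $\mathbb{E}_\xi[g(x_k,\xi)]=\nabla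 f(x_k)$ and $\mathbb{E}_\xi[\|g(x_k,\xi)-\nabla f(x_k)\|^2]\le\sigma^2$, $\sigma>0$. AS.5: $F(x,\xi)$ is twice continuously differentiable in $x$, $g(x,\xi)=\nabla_xF(x,\xi)$, and there is $\kappa>0$ with $\|\nabla^2_{xx}F(x,\xi)\|\le\kappa$ for all $x,\xi$. Constants. $\underline{\kappa},\bar{\kappa}$ are the positive constants in the bound $\underline{\kappa}I\preceq H_k\preceq\bar{\kappa}I$ (for all $k$), which the paper obtains under AS.5 with $\underline{\kappa}=\left(\frac{4p\kappa^2}{\delta}+(4p+1)(\kappa+\delta)\right)^{-1}$ and $\bar{\kappa}=\left(\frac{\alpha^{2p}-1}{\alpha^2-1}\right)\frac4\delta+\frac{\alpha^{2p}}{\delta}$, $\alpha=(4\kappa+5\delta)/\delta$; the initial matrix $H_1$ is taken to satisfy the same bounds.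
   Formalization: The lower bound κ̲I ⪯ H_k for 2 ≤ k ≤ N is assumed (a.s.): it does not follow from AS.5 for indefinite Hessians, as y^T y/(s^T y) can be unbounded. N_sfo ≤ 2N̄ is stated when N̄ equals the number Nm of calls for the g_k. *)

(* Defs.v *)
From HB Require Import structures.
From mathcomp Require Import all_boot all_order all_algebra.
From mathcomp Require Import all_classical all_reals all_analysis.

Set Implicit Arguments.
Unset Strict Implicit.
Unset Printing Implicit Defensive.

Import Order.TTheory GRing.Theory Num.Theory.
Import numFieldNormedType.Exports.

Local Open Scope classical_set_scope.
Local Open Scope ring_scope.

Definition dot (R : realType) (n : nat) (u v : 'cV[R]_n) : R :=
  (u^T *m v) 0 0.

(* The library norm `|v| on 'cV[R]_n is the max norm; this is the Euclidean
   one. The two induce the same topology. *)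
Definition enorm (R : realType) (n : nat) (v : 'cV[R]_n) : R :=
  Num.sqrt (dot v v).

Definition opnorm (R : realType) (n : nat) (A : 'M[R]_n) : R :=
  sup [set enorm (A *m v) | v in [set v : 'cV[R]_n | enorm v <= 1]].

Definition psd (R : realType) (n : nat) (A : 'M[R]_n) : Prop :=
  A^T = A /\ forall v : 'cV[R]_n, 0 <= dot v (A *m v).

Definition posdef (R : realType) (n : nat) (A : 'M[R]_n) : Prop :=
  A^T = A /\ forall v : 'cV[R]_n, v != 0 -> 0 < dot v (A *m v).

Definition loewner_le (R : realType) (n : nat) (A B : 'M[R]_n) : Prop :=
  psd (B - A).

Definition grad (R : realType) (n : nat) (h : 'cV[R]_n -> R) (x : 'cV[R]_n) :
    'cV[R]_n :=
  \col_(i < n) 'D_(delta_mx i 0) h x.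

Definition hess (R : realType) (n : nat) (h : 'cV[R]_n -> R) (x : 'cV[R]_n) :
    'M[R]_n :=
  \matrix_(i < n, j < n) 'D_(delta_mx j 0) (fun z => grad h z i 0) x.

Definition cont_diff (R : realType) (n : nat) (h : 'cV[R]_n -> R) : Prop :=
  (forall x, differentiable h x) /\ continuous (grad h).

Definition twice_cont_diff (R : realType) (n : nat) (h : 'cV[R]_n -> R) :
    Prop :=
  cont_diff h /\ forall i : 'I_n, cont_diff (fun x => grad h x i 0).

Definition borel (T : topologicalType) : set (set T) := <<s [set A | open A] >>.

Definition borel_fun (T U : topologicalType) (h : T -> U) : Prop :=
  forall B, borel B -> borel (h @^-1` B).

Definition random_element (d : measure_display) (Omega : measurableType d)
    (T : topologicalType) (X : Omega -> T) : Prop :=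
  forall B, borel B -> measurable (X @^-1` B).

Definition sigma_of (Omega : Type) (I : Type) (D : set I) (T : topologicalType)
    (X : I -> Omega -> T) : set (set Omega) :=
  <<s \bigcup_(i in D) [set X i @^-1` B | B in @borel T] >>.

Definition indep_classes (d : measure_display) (Omega : measurableType d)
    (R : realType) (P : probability Omega R) (G1 G2 : set (set Omega)) : Prop :=
  forall A B, G1 A -> G2 B -> P (A `&` B) = (P A * P B)%E.

Definition mutual_indep (d : measure_display) (Omega : measurableType d)
    (R : realType) (P : probability Omega R) (I : choiceType) (D : set I)
    (T : topologicalType) (X : I -> Omega -> T) : Prop :=
  forall (J : seq I) (B : I -> set T),
    uniq J -> (forall i, i \in J -> D i) -> (forall i, borel (B i)) ->
    P (\bigcap_(i in [set` J]) (X i @^-1` B i))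
      = (\prod_(i <- J) P (X i @^-1` B i))%E.

(* Iterations are numbered from 1 as in x_1, x_2, ...; the value at index 0 of a
   sequence indexed by iterations is never used. Inside a batch the samples are
   numbered from 0, so that batch k consists of z k 0, ..., z k (m k).-1. *)
Definition stoch_grad (R : realType) (n q : nat)
    (g : 'cV[R]_n -> 'cV[R]_q -> 'cV[R]_n) (m : nat -> nat)
    (x : nat -> 'cV[R]_n) (z : nat -> nat -> 'cV[R]_q) (k : nat) : 'cV[R]_n :=
  (m k)%:R^-1 *: \sum_(i < m k) g (x k) (z k i).

Definition sdiff (R : realType) (n : nat) (x : nat -> 'cV[R]_n) (j : nat) :
    'cV[R]_n :=
  x j.+1 - x j.

Definition ydiff (R : realType) (n q : nat)
    (g : 'cV[R]_n -> 'cV[R]_q -> 'cV[R]_n) (m : nat -> nat)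
    (x : nat -> 'cV[R]_n) (z : nat -> nat -> 'cV[R]_q) (j : nat) : 'cV[R]_n :=
  (m j)%:R^-1 *: \sum_(i < m j) (g (x j.+1) (z j i) - g (x j) (z j i)).

Definition gammaB (R : realType) (n : nat) (delta : R) (s y : nat -> 'cV[R]_n)
    (k : nat) : R :=
  Num.max (dot (y k.-1) (y k.-1) / dot (s k.-1) (y k.-1)) delta.

Definition Hinit (R : realType) (n : nat) (delta : R) (s y : nat -> 'cV[R]_n)
    (k : nat) : 'M[R]_n :=
  ((gammaB delta s y k)^-1)%:M.

Definition theta (R : realType) (n : nat) (delta : R) (s y : nat -> 'cV[R]_n)
    (j : nat) : R :=
  let c := dot (s j) (invmx (Hinit delta s y j.+1) *m s j) in
  if dot (s j) (y j) < 4^-1 * c then (3 / 4 * c) / (c - dot (s j) (y j)) else 1.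

Definition ybar (R : realType) (n : nat) (delta : R) (s y : nat -> 'cV[R]_n)
    (j : nat) : 'cV[R]_n :=
  theta delta s y j *: y j
    + (1 - theta delta s y j) *: (invmx (Hinit delta s y j.+1) *m s j).

Definition bfgs_update (R : realType) (n : nat) (H : 'M[R]_n)
    (s yb : 'cV[R]_n) : 'M[R]_n :=
  let rho := (dot s yb)^-1 in
  (1%:M - rho *: (s *m yb^T)) *m H *m (1%:M - rho *: (yb *m s^T))
    + rho *: (s *m s^T).

(* The matrix H_{k,i} when r correction pairs are in use. *)
Fixpoint Hrec (R : realType) (n : nat) (delta : R) (s y : nat -> 'cV[R]_n)
    (r k i : nat) : 'M[R]_n :=
  match i with
  | 0 => Hinit delta s y k
  | i'.+1 => let j := (k - (r - i + 1))%N in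
             bfgs_update (Hrec delta s y r k i') (s j) (ybar delta s y j)
  end.

(* At iteration k only the k - 1 pairs of indices 1, ..., k - 1 are available. *)
Definition SdLBFGS (R : realType) (n : nat) (delta : R) (p : nat)
    (s y : nat -> 'cV[R]_n) (k : nat) : 'M[R]_n :=
  let r := minn p k.-1 in Hrec delta s y r k r.

(* One realization of N iterations, for the realization z of the samples. *)
Definition sqn_run (R : realType) (n q : nat)
    (g : 'cV[R]_n -> 'cV[R]_q -> 'cV[R]_n) (m : nat -> nat) (alpha : nat -> R)
    (delta : R) (p : nat) (x1 : 'cV[R]_n) (H1 : 'M[R]_n) (N : nat)
    (z : nat -> nat -> 'cV[R]_q) (x : nat -> 'cV[R]_n) (H : nat -> 'M[R]_n) :
    Prop :=
  [/\ x 1%N = x1,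
      H 1%N = H1,
      forall k, (2 <= k <= N)%N ->
        H k = SdLBFGS delta p (sdiff x) (ydiff g m x z) k
    & forall k, (1 <= k <= N)%N ->
        x k.+1 = x k - alpha k *: (H k *m stoch_grad g m x z k)].

Definition grad_calls (m : nat -> nat) (N : nat) : nat :=
  \sum_(1 <= k < N.+1) m k.

(* The values g (x k) (z k.-1 i) entering y_{k-1}, for 2 <= k <= N; the values
   g (x k.-1) (z k.-1 i) are already known from the computation of g_{k-1}. *)
Definition diff_calls (m : nat -> nat) (N : nat) : nat :=
  \sum_(2 <= k < N.+1) m k.-1.

Definition sfo_calls (m : nat -> nat) (N : nat) : nat :=
  grad_calls m N + diff_calls m N.

Definition smooth_objective (R : realType) (n : nat) (f : 'cV[R]_n -> R)
    (flow L : R) : Prop :=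
  [/\ cont_diff f,
      forall x, flow <= f x
    & forall x y, enorm (grad f x - grad f y) <= L * enorm (x - y)].

Definition in_batch (m : nat -> nat) (N : nat) : set (nat * nat) :=
  [set ki | (1 <= ki.1 <= N)%N /\ (ki.2 < m ki.1)%N].

(* The expectation over the sample alone freezes x k at its value x k w, while
   the sample is evaluated at the integration variable w'. *)
Definition stochastic_oracle (d : measure_display) (Omega : measurableType d)
    (R : realType) (P : probability Omega R) (n q : nat) (f : 'cV[R]_n -> R)
    (g : 'cV[R]_n -> 'cV[R]_q -> 'cV[R]_n) (sigma : R) (m : nat -> nat)
    (N : nat) (x : nat -> Omega -> 'cV[R]_n)
    (xi : nat -> nat -> Omega -> 'cV[R]_q) : Prop :=
  [/\ mutual_indep P (in_batch m N) (fun ki => xi ki.1 ki.2),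
      forall k, (1 <= k <= N)%N ->
        indep_classes P (sigma_of [set i | (i < m k)%N] (xi k))
                        (sigma_of [set j | (1 <= j <= k)%N] x)
    & forall k i, (1 <= k <= N)%N -> (i < m k)%N ->
        {ae P, forall w,
          (forall l : 'I_n,
             P.-integrable setT (fun w' => (g (x k w) (xi k i w') l 0)%:E) /\
             'E_P[fun w' => (g (x k w) (xi k i w') l 0)%R]%E
               = (grad f (x k w) l 0)%:E) /\
          ('E_P[fun w' => (enorm (g (x k w) (xi k i w') - grad f (x k w)) ^+ 2)%R]
             <= (sigma ^+ 2)%:E)%E}].

Definition smooth_samples (R : realType) (n q : nat)
    (F : 'cV[R]_n -> 'cV[R]_q -> R) (g : 'cV[R]_n -> 'cV[R]_q -> 'cV[R]_n)
    (kappa : R) : Prop :=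
  [/\ forall z, twice_cont_diff (F ^~ z),
      forall x z, g x z = grad (F ^~ z) x
    & forall x z, opnorm (hess (F ^~ z) x) <= kappa].

Definition kappa_low (R : realType) (p : nat) (kappa delta : R) : R :=
  (4 * p%:R * kappa ^+ 2 / delta + (4 * p%:R + 1) * (kappa + delta))^-1.

Definition kappa_up (R : realType) (p : nat) (kappa delta : R) : R :=
  let a := (4 * kappa + 5 * delta) / delta in
  (a ^+ (2 * p) - 1) / (a ^+ 2 - 1) * (4 / delta) + a ^+ (2 * p) / delta.

Definition const1 (R : realType) (klo kup sigma L Dt Df : R) : R :=
  4 * sigma * kup ^+ 2 * Df / (klo ^+ 2 * Num.sqrt Dt) + sigma * L * Num.sqrt Dt.

Definition const2 (R : realType) (klo kup L Df : R) : R :=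
  4 * L * kup ^+ 2 * Df / klo ^+ 2.

Definition calls_threshold (R : realType) (klo kup sigma L Dt Df eps : R) : R :=
  Num.max (const1 klo kup sigma L Dt Df ^+ 2 / eps ^+ 2
             + 4 * const2 klo kup L Df / eps)
          (sigma ^+ 2 / (L ^+ 2 * Dt)).

Definition index_weight (R : realType) (klo kup L a : R) : R :=
  a * klo - a ^+ 2 * L * kup ^+ 2 / 2.

(* Main.v *)
(* Let e_k be the error of the batch gradient g_k. The matrix H_k and the iterate
   x_k are measurable functions of the samples of the earlier batches, so by
   independence E<grad f (x_k), H_k e_k> = 0, E<grad f (x_k), e_k> = 0 and
   E|e_k|^2 <= sigma^2 / m. Since klo I <= H_k and |H_k| <= kup, the quadratic
   upper bound on f gives
     E f (x_(k+1)) <= E f (x_k) - w E|grad f (x_k)|^2 + w sigma^2 / m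
   with w = klo^2 / (2 L kup^2), the weight of the index k. Summing over k and
   drawing the index independently with weights w yields
     E|grad f (x_tau)|^2 <= 2 L kup^2 D_f / (N klo^2) + sigma^2 / m,
   and with t^2 = Nbar the choice of m and N bounds the right-hand side by
   C_1 / t + C_2 / t^2 <= eps. *)
Require Import Defs.
From HB Require Import structures.
From mathcomp Require Import all_boot all_order all_algebra.
From mathcomp Require Import all_classical all_reals all_analysis.
From mathcomp Require Import measurable_realfun.
From mathcomp Require Import ring lra zify.

Set Implicit Arguments.
Unset Strict Implicit.
Unset Printing Implicit Defensive.

Import Order.TTheory GRing.Theory Num.Theory.
Import numFieldNormedType.Exports.

Local Open Scope classical_set_scope.
Local Open Scope ring_scope.

(** No conditional expectation is formed. The oracle hypothesis freezes x_k and integrates the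
    sample at a separate variable, so each use of independence is a Fubini argument for the product
    of two generated sigma-algebras: the one of a single sample and the one of all the other
    samples. The price is that x_k and H_k must be measurable for the coarse sigma-algebra. The run
    is therefore followed over an arbitrary measurable space, through the divisions and the case
    split of the damping, and the measurability of g is derived from that of F by difference
    quotients. Integrability of f (x_k) and of |grad f (x_k)|^2 is not given either; it is
    propagated along the induction that sums the descent inequalities. The bound [kup] comes from
    the damping: each update multiplies the operator norm by at most a^2, with a = (4 kappa + 5
    delta) / delta, and adds at most 4 / delta. *)

(** * Independence and decoupling *)

(* Unlike [integral_pushforward], this needs no integrability. *)
Lemma integral_distribution d d' (Omega : measurableType d)
  (T : measurableType d') (R : realType) (P : probability Omega R)
  (X : {mfun Omega >-> T}) (h : T -> \bar R) : measurable_fun setT h ->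
  (\int[distribution P X]_y h y = \int[P]_w h (X w))%E.
Proof.
move=> mh; rewrite [LHS]integralE [RHS]integralE.
have mX : measurable_fun setT X by exact: measurable_funPT.
rewrite (ge0_integral_pushforward mX P measurableT
  (measurable_funepos mh) (fun y _ => funepos_ge0 h y)) preimage_setT.
rewrite (ge0_integral_pushforward mX P measurableT
  (measurable_funeneg mh) (fun y _ => funeneg_ge0 h y)) preimage_setT.
by congr (_ - _)%E; apply: eq_integral => w _; rewrite /= ?funeposE ?funenegE.
Qed.

(* If A and B are independent, the law of (A, B) is the product law, so that
   Fubini's theorem computes an expectation of h (A, B) with B evaluated at a
   separate integration variable w'. *)
Section Decoupling.
Context d d1 d2 (Omega : measurableType d) (T1 : measurableType d1)
  (T2 : measurableType d2) (R : realType) (P : probability Omega R).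
Variables (A : Omega -> T1) (B : Omega -> T2).
Hypotheses (mA : measurable_fun setT A) (mB : measurable_fun setT B).
Hypothesis indepAB : forall X Y, measurable X -> measurable Y ->
  P (A @^-1` X `&` B @^-1` Y) = (P (A @^-1` X) * P (B @^-1` Y))%E.

HB.instance Definition _ := isMeasurableFun.Build _ _ _ _ A mA.
HB.instance Definition _ := isMeasurableFun.Build _ _ _ _ B mB.

Let AB w := (A w, B w).

Let mAB : measurable_fun setT AB.
Proof. exact/measurable_fun_pairP. Qed.

HB.instance Definition _ := isMeasurableFun.Build _ _ _ _ AB mAB.

Let lawAB X : measurable X ->
  (distribution P A \x distribution P B)%E X = distribution P AB X.
Proof.
by apply: product_measure_unique => X0 Y mX mY; exact: indepAB.
Qed.

(** Tonelli, hence no integrability: the second moment of the noise is bounded this way before it is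
    known to be finite. *)
Lemma ge0_decoupling (h : T1 * T2 -> \bar R) :
  measurable_fun [set: T1 * T2] h -> (forall z, 0 <= h z)%E ->
  (\int[P]_w h (A w, B w) = \int[P]_w \int[P]_w' h (A w, B w'))%E.
Proof.
move=> mh h0.
transitivity (\int[distribution P AB]_z h z)%E.
  by rewrite integral_distribution.
transitivity (\int[distribution P A \x distribution P B]_z h z)%E.
  by apply: eq_measure_integral => X mX _; apply: esym; exact: lawAB.
rewrite fubini_tonelli1// /fubini_F.
rewrite integral_distribution; last exact: measurable_fun_fubini_tonelli_F.
apply: eq_integral => w _ /=.
rewrite integral_distribution//; exact: measurableT_comp.
Qed.

Lemma ge0_decoupling_le (h : T1 * T2 -> \bar R) (c : R) :
  0 <= c -> measurable_fun [set: T1 * T2] h -> (forall z, 0 <= h z)%E ->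
  {ae P, forall w, (\int[P]_w' h (A w, B w') <= c%:E)%E} ->
  (\int[P]_w h (A w, B w) <= c%:E)%E.
Proof.
move=> c0 mh h0 hc; rewrite ge0_decoupling//.
have hE w : (\int[P]_w' h (A w, B w') = fubini_F (distribution P B) h (A w))%E.
  rewrite /fubini_F integral_distribution//; exact: measurableT_comp.
have mF : measurable_fun setT (fun w => (\int[P]_w' h (A w, B w'))%E).
  under eq_fun do rewrite hE.
  exact: (measurableT_comp (measurable_fun_fubini_tonelli_F _ mh h0) mA).
have cE : (\int[P]_w (cst c%:E) w = c%:E)%E.
  rewrite integral_cst// -[RHS]mule1; congr (_ * _)%E; exact: probability_setT.
rewrite -[leRHS]cE; apply: ae_ge0_le_integral => //.
- by move=> w _; exact: integral_ge0.
- by apply: filterS hc => w + _.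
Qed.

Lemma decoupling0 (h : T1 * T2 -> \bar R) :
  measurable_fun [set: T1 * T2] h ->
  P.-integrable setT (fun w => h (A w, B w)) ->
  {ae P, forall w, (\int[P]_w' h (A w, B w') = 0)%E} ->
  (\int[P]_w h (A w, B w) = 0)%E.
Proof.
move=> mh hint hae.
(* Fubini needs integrability for the product law; it is inherited from the pair [AB], which has
   this law. *)
have hintD : (distribution P A \x distribution P B)%E.-integrable setT h.
  apply/integrableP; split => //.
  have -> : (\int[distribution P A \x distribution P B]_z `|h z| =
     \int[distribution P AB]_z `|h z|)%E.
    by apply: eq_measure_integral => X mX _; exact: lawAB.
  rewrite integral_distribution; first by case/integrableP : hint.
  exact: measurableT_comp.
have mF := measurable_fubini_F hintD.
rewrite -(integral_distribution P AB mh).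
transitivity (\int[distribution P A \x distribution P B]_z h z)%E.
  by apply: eq_measure_integral => X mX _; apply: esym; exact: lawAB.
rewrite -(integral12_prod_meas1 hintD).
apply: (etrans (integral_distribution P A mF)).
rewrite -(integral0 P setT); apply: ae_eq_integral => //.
  exact: (measurableT_comp mF mA).
apply: filterS hae => w hw _; rewrite -[RHS]hw /fubini_F.
rewrite integral_distribution//; exact: measurableT_comp.
Qed.

End Decoupling.
(* The pi-lambda argument, with the finite-dimensional cylinders as pi-system. *)
Section Independence.
Context d (Omega : measurableType d) (R : realType) (P : probability Omega R).

(** For fixed [B] both sides are finite measures in [A], namely [P] restricted to [B] and [P] scaled
    by [P B]. They agree on the pi-system [C], which contains the whole space, so uniqueness of
    measures applies. *)
Lemma indep_generated (C : set (set Omega)) (B : set Omega) :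
  C `<=` measurable -> setI_closed C -> C setT -> measurable B ->
  (forall A, C A -> P (A `&` B) = (P A * P B)%E) ->
  forall A, <<s C >> A -> P (A `&` B) = (P A * P B)%E.
Proof.
move=> mC CI CT mB CB A CA.
have PB : P B = (NngNum (fine_ge0 (measure_ge0 P B)))%:num%:E.
  by rewrite fineK// fin_num_measure.
rewrite PB muleC.
apply: (@g_sigma_algebra_measure_unique _ _ _ C mC (fun=> setT) _ _
  (mrestr P mB) (mscale (NngNum (fine_ge0 (measure_ge0 P B))) P)) => //.
- by rewrite bigcup_const.
- by move=> A' CA'; apply: (etrans (CB _ CA')); rewrite PB muleC.
- by move=> _; apply: (le_lt_trans (probability_le1 P (measurableI _ _ measurableT mB)));
     rewrite ltry.
Qed.

Lemma indep_generated2 (C1 C2 : set (set Omega)) :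
  C1 `<=` measurable -> setI_closed C1 -> C1 setT ->
  C2 `<=` measurable -> setI_closed C2 -> C2 setT ->
  indep_classes P C1 C2 -> indep_classes P <<s C1 >> <<s C2 >>.
Proof.
move=> mC1 C1I C1T mC2 C2I C2T C12 A B A1 B2.
have sm (C : set (set Omega)) : C `<=` measurable -> <<s C >> `<=` measurable.
  by move=> mC; apply: smallest_sub => //; exact: sigma_algebra_measurable.
apply: (indep_generated mC1 C1I C1T) => //; first exact: (sm _ mC2).
move=> A' A'1; rewrite setIC muleC.
apply: (indep_generated mC2 C2I C2T) => //; first exact: mC1.
by move=> B' B'2; rewrite setIC muleC; exact: C12.
Qed.

Context (I : choiceType) (T : ptopologicalType) (X : I -> Omega -> T).

Definition cylinders (D : set I) : set (set Omega) :=
  [set A | exists J : seq I, exists B : I -> set T,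
     [/\ uniq J, forall i, i \in J -> D i, forall i, borel (B i)
       & A = \bigcap_(i in [set` J]) (X i @^-1` B i)]].

Lemma borelT : borel [set: T].
Proof. by apply: sub_sigma_algebra; exact: openT. Qed.

Lemma borelI (A B : set T) : borel A -> borel B -> borel (A `&` B).
Proof.
exact: (@measurableI _ (g_sigma_algebraType [set A : set T | open A])).
Qed.

Lemma cylindersI D : setI_closed (cylinders D).
Proof.
move=> _ _ [J [B [uJ JD mB ->]]] [J' [B' [uJ' J'D mB' ->]]].
(* An index absent from one list is constrained by [setT] there, so an index of both lists receives
   the intersection of its two sets. *)
exists (undup (J ++ J')), (fun i => (if i \in J then B i else setT) `&`
                           (if i \in J' then B' i else setT)); split.
- exact: undup_uniq.
- by move=> i; rewrite mem_undup mem_cat => /orP[/JD|/J'D].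
- by move=> i; apply: borelI; case: ifP => // _; exact: borelT.
- apply/seteqP; split=> w /=.
    move=> [wB wB'] i /=; rewrite mem_undup mem_cat => _; split.
      by case: ifPn => // iJ; exact: wB.
    by case: ifPn => // iJ; exact: wB'.
  move=> wBB; split => i /= iJ.
    have [|] := wBB i; first by rewrite /= mem_undup mem_cat iJ.
    by rewrite iJ.
  have [|_] := wBB i; first by rewrite /= mem_undup mem_cat iJ orbT.
  by rewrite iJ.
Qed.

Lemma cylindersT D : cylinders D setT.
Proof.
exists [::], (fun=> setT); split => //; first by move=> _; exact: borelT.
by apply/seteqP; split.
Qed.

Lemma sigma_of_cylinders D : sigma_of D X `<=` <<s cylinders D >>.
Proof.
apply: smallest_sub; first exact: smallest_sigma_algebra.
move=> _ [i Di] [B mB <-]; apply: sub_sigma_algebra.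
exists [:: i], (fun=> B); split => //.
- by move=> j; rewrite inE => /eqP ->.
- apply/seteqP; split=> w /= => [wB j|].
    by rewrite /= inE => /eqP ->.
  by apply; rewrite /= inE.
Qed.

(** On cylinders, mutual independence is used for [J], for [J'] and for [J ++ J']; disjointness
    makes the concatenation free of duplicates and the choice [C] unambiguous. *)
Lemma mutual_indep_disjoint (D D1 D2 : set I) :
  (forall i, D i -> random_element (X i)) -> mutual_indep P D X ->
  D1 `<=` D -> D2 `<=` D -> D1 `&` D2 = set0 ->
  indep_classes P (sigma_of D1 X) (sigma_of D2 X).
Proof.
move=> mX indX D1D D2D D12 A B /sigma_of_cylinders A1 /sigma_of_cylinders B2.
have mC D' : D' `<=` D -> cylinders D' `<=` measurable.
  move=> D'D _ [J [C [uJ JD mC ->]]].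
  apply: fin_bigcap_measurable; first exact: finite_seq.
  by move=> i /JD /D'D Di; exact: mX.
apply: (indep_generated2 (mC _ D1D) (@cylindersI D1) (@cylindersT D1)
  (mC _ D2D) (@cylindersI D2) (@cylindersT D2)) => // {A B A1 B2}.
move=> _ _ [J [B [uJ JD mB ->]]] [J' [B' [uJ' J'D mB' ->]]].
have JJ' i : i \in J -> i \in J' -> False.
  by move=> /JD D1i /J'D D2i; have : set0 i by rewrite -D12.
pose C i := if i \in J then B i else B' i.
have -> : \bigcap_(i in [set` J]) (X i @^-1` B i)
    `&` \bigcap_(i in [set` J']) (X i @^-1` B' i)
  = \bigcap_(i in [set` J ++ J']) (X i @^-1` C i).
  apply/seteqP; split => w /=.
    move=> [wB wB'] i /=; rewrite mem_cat /C.
    by case: ifPn => iJ /=; [move=> _; exact: wB|exact: wB'].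
  move=> wC; split => i /= iJ.
    by have := wC i; rewrite /= mem_cat /C iJ; exact.
  have := wC i; rewrite /= mem_cat iJ orbT /C.
  by case: ifPn => [/JJ' /(_ iJ)|_]//; exact.
rewrite indX//; last 3 first.
- rewrite cat_uniq uJ uJ' andbT /=; apply/hasPn => i iJ'; apply/negP => iJ.
  exact: JJ' iJ iJ'.
- by move=> i; rewrite mem_cat => /orP[iJ|iJ]; [exact: D1D (JD _ iJ)|exact: D2D (J'D _ iJ)].
- by move=> i; rewrite /C; case: ifP.
rewrite big_cat/= !indX//; last 2 first.
- by move=> i iJ; exact: D2D (J'D _ iJ).
- by move=> i iJ; exact: D1D (JD _ iJ).
congr (_ * _)%E; apply: eq_big_seq => i iJ; rewrite /C.
  by rewrite iJ.
by case: ifPn => // /JJ' /(_ iJ).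
Qed.

End Independence.

(** * Euclidean geometry and the upper bound on the SdLBFGS matrices *)

Section Euclidean.
Context (R : realType) (n : nat).
Implicit Types (u v : 'cV[R]_n) (A B : 'M[R]_n).

Lemma dotE u v : dot u v = \sum_i u i 0 * v i 0.
Proof. by rewrite /dot mxE; apply: eq_bigr => i _; rewrite mxE. Qed.

Lemma dotC u v : dot u v = dot v u.
Proof. by rewrite !dotE; apply: eq_bigr => i _; rewrite mulrC. Qed.

Lemma dotDr u v w : dot u (v + w) = dot u v + dot u w.
Proof. by rewrite /dot mulmxDr mxE. Qed.

Lemma dotDl u v w : dot (u + v) w = dot u w + dot v w.
Proof. by rewrite dotC dotDr !(dotC w). Qed.

Lemma dotZr a u v : dot u (a *: v) = a * dot u v.
Proof. by rewrite /dot -scalemxAr mxE. Qed.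

Lemma dotZl a u v : dot (a *: u) v = a * dot u v.
Proof. by rewrite dotC dotZr dotC. Qed.

Lemma dotNr u v : dot u (- v) = - dot u v.
Proof. by rewrite -scaleN1r dotZr mulN1r. Qed.

Lemma dotNl u v : dot (- u) v = - dot u v.
Proof. by rewrite dotC dotNr dotC. Qed.

Lemma dotBr u v w : dot u (v - w) = dot u v - dot u w.
Proof. by rewrite dotDr dotNr. Qed.

Lemma dotBl u v w : dot (u - v) w = dot u w - dot v w.
Proof. by rewrite dotDl dotNl. Qed.

Lemma dot0r u : dot u 0 = 0.
Proof. by rewrite /dot mulmx0 mxE. Qed.

Lemma dot_sumr I (s : seq I) (F : I -> 'cV[R]_n) u :
  dot u (\sum_(i <- s) F i) = \sum_(i <- s) dot u (F i).
Proof. by rewrite /dot mulmx_sumr summxE. Qed.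

Lemma dot_mulmxr A u v : dot u (A *m v) = dot (A^T *m u) v.
Proof. by rewrite /dot trmx_mul trmxK mulmxA. Qed.

Lemma dot_delta i u : dot (delta_mx i 0) u = u i 0.
Proof.
rewrite dotE (bigD1 i)//= mxE !eqxx mul1r big1 ?addr0// => j ji.
by rewrite mxE (negPf ji) mul0r.
Qed.

Lemma dot_ge0 v : 0 <= dot v v.
Proof. by rewrite dotE sumr_ge0// => i _; rewrite -expr2 sqr_ge0. Qed.

Lemma dot_gt0 v : v != 0 -> 0 < dot v v.
Proof.
move=> v0; rewrite lt_neqAle dot_ge0 andbT eq_sym; apply: contra v0.
rewrite dotE psumr_eq0 => [/allP vi0|i _]; last by rewrite -expr2 sqr_ge0.
apply/eqP/matrixP => i j; rewrite (ord1 j) mxE; apply/eqP.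
by have := vi0 i (mem_index_enum _); rewrite /= mulf_eq0 orbb.
Qed.

Lemma enorm_ge0 v : 0 <= enorm v. Proof. exact: sqrtr_ge0. Qed.

Lemma enorm_sqr v : enorm v ^+ 2 = dot v v.
Proof. by rewrite sqr_sqrtr// dot_ge0. Qed.

Lemma enorm_gt0 v : v != 0 -> 0 < enorm v.
Proof. by move=> v0; rewrite sqrtr_gt0 dot_gt0. Qed.

Lemma enorm_eq0 v : (enorm v == 0) = (v == 0).
Proof.
apply/idP/idP => [|/eqP ->]; last by rewrite /enorm dot0r sqrtr0.
by apply: contraTT => /enorm_gt0; rewrite lt_neqAle eq_sym => /andP[].
Qed.

Lemma enormZ a v : enorm (a *: v) = `|a| * enorm v.
Proof. by rewrite /enorm dotZl dotZr mulrA -expr2 sqrtrM ?sqr_ge0// sqrtr_sqr. Qed.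

Lemma enormN v : enorm (- v) = enorm v.
Proof. by rewrite -scaleN1r enormZ normrN1 mul1r. Qed.

Lemma discriminant_le (a b c : R) : 0 <= a ->
  (forall t, 0 <= c - 2 * t * b + t ^+ 2 * a) -> b ^+ 2 <= c * a.
Proof.
rewrite le_eqVlt => /predU1P[<-|a0] q.
  suff -> : b = 0 by rewrite expr0n mulr0.
  (* For [a = 0] the polynomial is affine in [t]; at this point its value would be -1. *)
  apply/eqP/negPn/negP => b0; have := q ((c + 1) / (2 * b)).
  rewrite mulr0 addr0; suff -> : 2 * ((c + 1) / (2 * b)) * b = c + 1 by lra.
  by field.
(* The minimizer of the quadratic. *)
have := q (b / a).
have -> : c - 2 * (b / a) * b + (b / a) ^+ 2 * a = (c * a - b ^+ 2) / a.
  by field; rewrite gt_eqF.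
by rewrite pmulr_lge0 ?invr_gt0// subr_ge0.
Qed.

Lemma psd_cauchy_schwarz A u v : psd A ->
  dot u (A *m v) ^+ 2 <= dot u (A *m u) * dot v (A *m v).
Proof.
move=> [At A0]; apply: discriminant_le => // t.
have := A0 (u - t *: v).
rewrite mulmxBr -scalemxAr !dotBl !dotBr !dotZl !dotZr.
rewrite (dot_mulmxr A v u) At (dotC (A *m v) u).
by congr (_ <= _); ring.
Qed.

Lemma cauchy_schwarz_sqr u v : dot u v ^+ 2 <= dot u u * dot v v.
Proof.
have := @psd_cauchy_schwarz 1%:M u v; rewrite !mul1mx; apply.
by split => [|w]; rewrite ?trmx1 ?mul1mx ?dot_ge0.
Qed.

Lemma cauchy_schwarz u v : `|dot u v| <= enorm u * enorm v.
Proof.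
rewrite -(@ler_pXn2r _ 2)// ?nnegrE ?mulr_ge0 ?enorm_ge0//.
by rewrite exprMn !enorm_sqr real_normK ?num_real// cauchy_schwarz_sqr.
Qed.

Lemma dot_le_enorm u v : dot u v <= enorm u * enorm v.
Proof. exact: le_trans (ler_norm _) (cauchy_schwarz _ _). Qed.

Lemma enormD u v : enorm (u + v) <= enorm u + enorm v.
Proof.
rewrite -(@ler_pXn2r _ 2)// ?nnegrE ?addr_ge0 ?enorm_ge0//.
rewrite sqrrD !enorm_sqr dotDl !dotDr (dotC v u).
by have := dot_le_enorm u v; lra.
Qed.

Lemma enorm_sum I (s : seq I) (F : I -> 'cV[R]_n) :
  enorm (\sum_(i <- s) F i) <= \sum_(i <- s) enorm (F i).
Proof.
elim/big_ind2 : _ => [|u a v b ua vb|//]; first by rewrite /enorm dot0r sqrtr0.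
exact: le_trans (enormD _ _) (lerD ua vb).
Qed.

Lemma entry_le_enorm u i : `|u i 0| <= enorm u.
Proof.
have e1 : enorm (delta_mx i 0 : 'cV[R]_n) = 1.
  by rewrite /enorm dot_delta mxE !eqxx sqrtr1.
by have := cauchy_schwarz (delta_mx i 0) u; rewrite e1 mul1r dot_delta.
Qed.

(** A pointwise form of a bound on the operator norm: it adds and composes without any handling of
    the supremum in [opnorm]. *)
Definition opbound A (c : R) := forall v, enorm (A *m v) <= c * enorm v.

Lemma opbound_mul A B a b : 0 <= a ->
  opbound A a -> opbound B b -> opbound (A *m B) (a * b).
Proof.
move=> a0 Aa Bb v; rewrite -mulmxA (le_trans (Aa _))// -mulrA ler_wpM2l//.
Qed.

Lemma opboundD A B a b : opbound A a -> opbound B b -> opbound (A + B) (a + b).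
Proof.
by move=> Aa Bb v; rewrite mulmxDl mulrDl (le_trans (enormD _ _))// lerD.
Qed.

Lemma opbound_rank1 u v (a c : R) :
  `|a| * (enorm u * enorm v) <= c -> opbound (a *: (u *m v^T)) c.
Proof.
move=> ac w; rewrite -scalemxAl enormZ -mulmxA [v^T *m w]mx11_scalar -/(dot v w).
rewrite mul_mx_scalar enormZ; apply: le_trans (ler_wpM2r (enorm_ge0 w) ac).
rewrite -mulrA ler_wpM2l//; have := cauchy_schwarz v w.
by have := enorm_ge0 u; nra.
Qed.

Lemma opbound1 : opbound 1%:M 1.
Proof. by move=> v; rewrite mul1mx mul1r. Qed.

Lemma opboundN A a : opbound A a -> opbound (- A) a.
Proof. by move=> Aa v; rewrite mulNmx enormN. Qed.

Lemma opbound_le A a b : a <= b -> opbound A a -> opbound A b.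
Proof.
by move=> ab Aa v; rewrite (le_trans (Aa v))// ler_wpM2r// enorm_ge0.
Qed.

(** Cauchy-Schwarz for the form of [A] at [A *m v] and [v] gives |Av|^4 <= (c |Av|^2) (c |v|^2);
    divide by |Av|^2. This serves the given matrix [H1], which no update produces. *)
Lemma psd_opbound A c : psd A -> loewner_le A c%:M -> opbound A c.
Proof.
move=> Apsd [_ cA] v.
have ub w : dot w (A *m w) <= c * dot w w.
  by have := cA w; rewrite mulmxBl dotBr mul_scalar_mx dotZr subr_ge0.
have [->|v0] := eqVneq v 0; first by rewrite mulmx0 /enorm dot0r sqrtr0 mulr0.
have c0 : 0 <= c.
  have /(_ v)/le_trans/(_ (ub v)) := Apsd.2.
  by rewrite pmulr_lge0// dot_gt0.
have := psd_cauchy_schwarz (A *m v) v Apsd.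
have [->|Av0] := eqVneq (A *m v) 0.
  by move=> _; rewrite /enorm dot0r sqrtr0 mulr_ge0// enorm_ge0.
move=> cs; rewrite -(@ler_pXn2r _ 2)// ?nnegrE ?mulr_ge0 ?enorm_ge0//.
rewrite exprMn !enorm_sqr -(ler_pM2l (dot_gt0 Av0)) -expr2 (le_trans cs)//.
have := ler_pM (Apsd.2 (A *m v)) (Apsd.2 v) (ub _) (ub v).
by move=> /le_trans; apply; rewrite expr2; lra.
Qed.

End Euclidean.

Section SdLBFGSUpperBound.
Context (R : realType) (n : nat) (kappa delta : R).
Hypotheses (kappa_gt0 : 0 < kappa) (delta_gt0 : 0 < delta).
Implicit Types (s y : nat -> 'cV[R]_n).

(** [r] bounds the norm of the rank-one matrices in the two outer factors, each of norm at most 1 +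
    r, and [t] bounds the norm of the added term. *)
Lemma opbound_bfgs_update (H : 'M[R]_n) (s yb : 'cV[R]_n) (h r t : R) :
  0 <= r -> 0 <= h -> 0 < dot s yb -> opbound H h ->
  enorm s * enorm yb <= r * dot s yb -> dot s s <= t * dot s yb ->
  opbound (bfgs_update H s yb) ((1 + r) ^+ 2 * h + t).
Proof.
move=> r0 h0 syb0 Hh ssyb sst; rewrite /bfgs_update.
have rank1 (u v : 'cV[R]_n) : enorm u * enorm v <= r * dot s yb ->
    opbound (1%:M - (dot s yb)^-1 *: (u *m v^T)) (1 + r).
  move=> uv; apply: opboundD; first exact: opbound1.
  apply: opboundN; apply: opbound_rank1.
  by rewrite gtr0_norm ?invr_gt0// mulrC ler_pdivrMr.
apply: opboundD.
  rewrite expr2 mulrAC; have r10 : 0 <= 1 + r by rewrite addr_ge0.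
  apply: opbound_mul; [exact: mulr_ge0| |by apply: rank1; rewrite mulrC].
  by apply: opbound_mul => //; exact: rank1.
apply: opbound_rank1.
by rewrite gtr0_norm ?invr_gt0// mulrC ler_pdivrMr// -expr2 enorm_sqr.
Qed.

Lemma gammaB_ge s y k : delta <= gammaB delta s y k.
Proof. by rewrite /gammaB le_max lexx orbT. Qed.

Lemma gammaB_gt0 s y k : 0 < gammaB delta s y k.
Proof. exact: lt_le_trans (gammaB_ge _ _ _). Qed.

Lemma invmx_Hinit s y k : invmx (Hinit delta s y k) = (gammaB delta s y k)%:M.
Proof. by rewrite /Hinit invmx_scalar invrK. Qed.

Lemma theta_damping s y j : s j != 0 ->
  let c := gammaB delta s y j.+1 * dot (s j) (s j) in
  [/\ 0 <= theta delta s y j, theta delta s y j <= 1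
    & c / 4 <= dot (s j) (ybar delta s y j)].
Proof.
move=> sj0 c.
have c0 : 0 < c by rewrite mulr_gt0 ?gammaB_gt0 ?dot_gt0.
rewrite /ybar dotDr !dotZr /theta invmx_Hinit mul_scalar_mx dotZr -/c.
clearbody c; case: ltP => [syc|csy]; last
  by rewrite subrr mul0r addr0 mul1r; split=> //; rewrite mulrC.
have csy0 : 0 < c - dot (s j) (y j) by lra.
split.
- by rewrite divr_ge0 ?ltW//; lra.
- by rewrite ler_pdivrMr//; lra.
(* In the damped case [theta] is chosen so that s^T ybar = c - theta (c - s^T y) is exactly c /
   4. *)
rewrite [leRHS](_ : _ = c / 4) //; field; exact: lt0r_neq0.
Qed.

Lemma growth_gt1 : 1 < (4 * kappa + 5 * delta) / delta.
Proof.
by rewrite ltr_pdivlMr//; move: kappa_gt0 delta_gt0; lra.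
Qed.

(* Damping gives s^T ybar >= gamma |s|^2 / 4 and |ybar| <= (kappa + gamma) |s|,
   hence |s| |ybar| / (s^T ybar) <= 4 kappa / delta + 4 since gamma >= delta. No
   bound on gamma from above is needed. *)
Lemma opbound_Hrec s y r k i : (i <= r < k)%N ->
  (forall j, (1 <= j < k)%N -> s j != 0 /\ enorm (y j) <= kappa * enorm (s j)) ->
  opbound (Hrec delta s y r k i) (kappa_up i kappa delta).
Proof.
move=> /andP[ir rk] sy.
pose a : R := (4 * kappa + 5 * delta) / delta.
have a1 : 1 < a := growth_gt1.
have aE : a = 1 + (4 * kappa / delta + 4) by rewrite /a; field; exact: lt0r_neq0.
have a21 : 0 < a ^+ 2 - 1 by rewrite subr_gt0 exprn_egt1.
have B0 l : 0 <= kappa_up l kappa delta.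
  have al1 : 1 <= a ^+ (2 * l) by rewrite exprn_ege1// ltW.
  rewrite /kappa_up -/a; apply: addr_ge0.
    apply: mulr_ge0; last by rewrite divr_ge0 ?ltW.
    by apply: divr_ge0; [rewrite subr_ge0|exact: ltW].
  by apply: divr_ge0; [exact: le_trans al1|exact: ltW].
elim: i ir => [|i IHi] ir.
  rewrite /= /Hinit => v; rewrite mul_scalar_mx enormZ ler_wpM2r ?enorm_ge0//.
  rewrite /kappa_up -/a muln0 expr0 subrr !mul0r add0r div1r.
  rewrite ger0_norm ?invr_ge0 ?(ltW (gammaB_gt0 _ _ _))//.
  by rewrite lef_pV2 ?posrE ?gammaB_gt0// gammaB_ge.
rewrite /=; set j := (k - _)%N.
have jk : (1 <= j < k)%N by rewrite /j; lia.
have [sj0 yj] := sy j jk.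
have [t0 t1 syb] := theta_damping y sj0.
(* Pair [j] is damped with its own gamma, of index [j.+1], not with the gamma of iteration [k]; the
   lower bound [delta] is common to all of them. *)
have g0 := gammaB_gt0 s y j.+1; have gd := gammaB_ge s y j.+1.
set g := gammaB delta s y j.+1 in syb g0 gd *.
have ss0 := dot_gt0 sj0.
have syb0 : 0 < dot (s j) (ybar delta s y j).
  by rewrite (lt_le_trans _ syb)// divr_gt0// mulr_gt0.
(* [kappa_up] is the closed form, a geometric sum, of B_0 = 1 / delta and B_(i+1) = a^2 B_i + 4 /
   delta. *)
have -> : kappa_up i.+1 kappa delta =
    (1 + (4 * kappa / delta + 4)) ^+ 2 * kappa_up i kappa delta + 4 / delta.
  rewrite -aE /kappa_up -/a mulnS exprD; field.
  by rewrite (gt_eqF a21) gt_eqF.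
apply: opbound_bfgs_update => //.
- by rewrite addr_ge0// divr_ge0 ?mulr_ge0 ?ltW.
- exact: IHi (ltnW ir).
- have ybn : enorm (ybar delta s y j) <= (kappa + g) * enorm (s j).
    rewrite /ybar invmx_Hinit mul_scalar_mx -/g scalerA.
    apply: (le_trans (enormD _ _)); rewrite !enormZ [leRHS]mulrDl; apply: lerD.
      rewrite ger0_norm//; apply: le_trans yj.
      by rewrite ler_piMl// enorm_ge0.
    rewrite ger0_norm ?mulr_ge0 ?subr_ge0 ?(ltW g0)//.
    by rewrite ler_wpM2r ?enorm_ge0// ler_piMl ?(ltW g0)// lerBlDr lerDl.
  apply: (le_trans (ler_wpM2l (enorm_ge0 _) ybn)).
  rewrite mulrCA -expr2 enorm_sqr.
  have rg : kappa + g <= (4 * kappa / delta + 4) * (g / 4).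
    rewrite [leRHS](_ : _ = kappa * (g / delta) + g); last first.
      by field; rewrite gt_eqF.
    by rewrite lerD2r ler_pMr// ler_pdivlMr// mul1r.
  apply: (le_trans (ler_wpM2r (ltW ss0) rg)).
  rewrite -[leLHS]mulrA; apply: ler_wpM2l; last by rewrite mulrAC.
  by rewrite addr_ge0// divr_ge0 ?mulr_ge0 ?ltW.
- have dg : dot (s j) (s j) <= 4 / delta * (g * dot (s j) (s j) / 4).
    rewrite [leRHS](_ : _ = g / delta * dot (s j) (s j)); last first.
      by field; rewrite gt_eqF.
    by rewrite ler_peMl ?(ltW ss0)// ler_pdivlMr// mul1r.
  apply: (le_trans dg); rewrite ler_wpM2l//.
  by rewrite divr_ge0 ?ltW.
Qed.

(** Early iterations use fewer than [p] pairs; monotonicity extends the bound for [p] pairs to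
    them. *)
Lemma kappa_up_le i j : (i <= j)%N -> kappa_up i kappa delta <= kappa_up j kappa delta.
Proof.
move=> ij; have a1 := growth_gt1.
have aij : ((4 * kappa + 5 * delta) / delta) ^+ (2 * i) <=
    ((4 * kappa + 5 * delta) / delta) ^+ (2 * j).
  by rewrite ler_weXn2l ?(ltW a1)// leq_mul2l.
rewrite /kappa_up /= lerD//; last by rewrite ler_wpM2r// invr_ge0 ltW.
rewrite ler_wpM2r//; first by rewrite divr_ge0 ?ltW.
rewrite ler_wpM2r ?lerD2r// invr_ge0 subr_ge0 exprn_ege1// ltW//.
Qed.

Lemma kappa_up_gt0 p : 0 < kappa_up p kappa delta.
Proof.
apply: lt_le_trans (kappa_up_le (leq0n p)).
by rewrite /kappa_up muln0 expr0 subrr !mul0r add0r divr_gt0.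
Qed.

Lemma opbound_SdLBFGS s y p k : (2 <= k)%N ->
  (forall j, (1 <= j < k)%N -> s j != 0 /\ enorm (y j) <= kappa * enorm (s j)) ->
  opbound (SdLBFGS delta p s y k) (kappa_up p kappa delta).
Proof.
move=> k2 sy; apply: (opbound_le (kappa_up_le (geq_minl p k.-1))).
by apply: opbound_Hrec => //; rewrite leqnn/=; lia.
Qed.

End SdLBFGSUpperBound.

(** * Mean value estimates *)

Section OperatorNorm.
Context (R : realType) (n : nat).
Implicit Types (u v : 'cV[R]_n) (A : 'M[R]_n).

(** A crude bound, which shows that the set in [opnorm] is bounded above, so that its [sup] is an
    upper bound. *)
Lemma enorm_mulmx_col A v :
  enorm (A *m v) <= (\sum_i enorm (col i A)) * enorm v.
Proof.
have -> : A *m v = \sum_i v i 0 *: col i A.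
  apply/matrixP => i j; rewrite (ord1 j) summxE mxE.
  by apply: eq_bigr => k _; rewrite !mxE mulrC.
apply: (le_trans (enorm_sum _ _)); rewrite mulr_suml; apply: ler_sum => i _.
by rewrite enormZ mulrC ler_wpM2l ?enorm_ge0// entry_le_enorm.
Qed.

Lemma opbound_opnorm A : opbound A (opnorm A).
Proof.
move=> v; have [->|v0] := eqVneq v 0.
  by rewrite mulmx0 /enorm dot0r sqrtr0 mulr0.
have v1 : enorm ((enorm v)^-1 *: v) <= 1.
  by rewrite enormZ ger0_norm ?invr_ge0 ?enorm_ge0// mulVf// enorm_eq0.
have : enorm (A *m ((enorm v)^-1 *: v)) <= opnorm A.
  apply: sup_ubound; last by exists ((enorm v)^-1 *: v).
  exists (\sum_i enorm (col i A)) => _ [w /= w1 <-].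
  apply: (le_trans (enorm_mulmx_col _ _)).
  by rewrite ler_piMr// sumr_ge0// => i _; exact: enorm_ge0.
rewrite -scalemxAr enormZ ger0_norm ?invr_ge0 ?enorm_ge0//.
by rewrite mulrC ler_pdivrMr// enorm_gt0.
Qed.

End OperatorNorm.

Section LineDerivatives.
Context (R : realType) (n : nat).
Implicit Types (x s : 'cV[R]_n) (h : 'cV[R]_n -> R).

Lemma derive_dot_grad h x s : differentiable h x ->
  'D_s h x = dot (grad h x) s.
Proof.
move=> dh; rewrite deriveE// dotE [in LHS](_ : s = \sum_i s i 0 *: delta_mx i 0).
  rewrite linear_sum; apply: eq_bigr => i _.
  by rewrite linearZ /= /grad mxE deriveE// mulrC.
apply/matrixP => i j; rewrite (ord1 j) summxE (bigD1 i)//= !mxE !eqxx mulr1.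
by rewrite big1 ?addr0// => k ki; rewrite !mxE eq_sym (negPf ki) mulr0.
Qed.

Lemma is_derive_line h x s (t : R) : differentiable h (x + t *: s) ->
  is_derive t 1 (fun t => h (x + t *: s)) (dot (grad h (x + t *: s)) s).
Proof.
move=> dh; rewrite -derive_dot_grad//.
have quot : (fun e : R => e^-1 *: (((fun t => h (x + t *: s)) \o shift t) (e *: 1)
    - h (x + t *: s))) =
  (fun e : R => e^-1 *: ((h \o shift (x + t *: s)) (e *: s) - h (x + t *: s))).
  apply/funext => e /=; congr (_ *: (h _ - _)).
  by rewrite (_ : e *: (1 : R) = e) ?scalerDl 1?addrCA// /GRing.scale /= mulr1.
apply: DeriveDef.
  by rewrite /derivable quot; exact: diff_derivable.
by rewrite /derive quot.
Qed.

(** Instead of integrating the gradient along the segment, subtract the part [a * t + b * t ^+ 2] of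
    the claimed majorant: the Lipschitz bound makes the derivative of the difference nonpositive on
    ]0, 1[, and the mean value theorem concludes. *)
Lemma descent_lemma h (L : R) x s :
  (forall x, differentiable h x) ->
  (forall x y, enorm (grad h x - grad h y) <= L * enorm (x - y)) ->
  h (x + s) <= h x + dot (grad h x) s + L / 2 * enorm s ^+ 2.
Proof.
move=> dh Lh.
pose a := dot (grad h x) s; pose b := L / 2 * enorm s ^+ 2.
pose phi (t : R) := h (x + t *: s) - (a * t + b * t ^+ 2).
pose dphi (t : R) := dot (grad h (x + t *: s)) s - (a + b * (2 * t)).
have dphiP (t : R) : is_derive t 1 phi (dphi t).
  apply: is_deriveB; first exact: is_derive_line.
  have -> : (fun t : R => a * t + b * t ^+ 2) =
      (a \*: (id : R -> R)) + (b \*: ((id : R -> R) ^+ 2)).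
    by apply/funext => r; rewrite [in RHS]addrfctE [in RHS]exprfctE.
  apply: is_derive_eq; rewrite /GRing.scale /= !mulr1 expr1.
  by rewrite mulrA.
have [c c01 E] : exists2 c, c \in `]0, 1[%R & phi 1 - phi 0 = dphi c * (1 - 0).
  apply: MVT => //.
  by apply: derivable_within_continuous => t _.
move: c01; rewrite in_itv /= => /andP[c0 _].
have dphi_le0 : dphi c <= 0.
  have -> : dphi c = dot (grad h (x + c *: s) - grad h x) s - L * c * enorm s ^+ 2.
    by rewrite /dphi /a /b dotBl; field.
  have := Lh (x + c *: s) x; rewrite addrAC subrr add0r enormZ gtr0_norm// => Lc.
  rewrite subr_le0; apply: (le_trans (dot_le_enorm _ _)).
  apply: (le_trans (ler_wpM2r (enorm_ge0 _) Lc)).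
  by rewrite expr2 !mulrA.
have : phi 1 <= phi 0 by rewrite -subr_le0 E subr0 mulr1.
rewrite /phi scale1r scale0r addr0 expr1n expr0n !mulr0 !mulr1 addr0 subr0.
by rewrite /a /b; lra.
Qed.

(** The mean value theorem is scalar, so the gradient along the segment is paired with the fixed
    vector [u], its own increment. The increment of [phi] is then |u|^2, and the derivative is at
    most |u| kappa |s|; divide by |u|. *)
Lemma grad_lipschitz h (kappa : R) x y : twice_cont_diff h ->
  (forall x, opnorm (hess h x) <= kappa) ->
  enorm (grad h x - grad h y) <= kappa * enorm (x - y).
Proof.
move=> [_ ddh] hk; set u := grad h x - grad h y; set s := x - y.
pose hi i z := grad h z i 0.
pose phi (t : R) := \sum_(i < n) u i 0 * hi i (y + t *: s).
pose dphi (t : R) := \sum_(i < n) u i 0 * dot (grad (hi i) (y + t *: s)) s.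
have dphiP (t : R) : is_derive t 1 phi (dphi t).
  have -> : phi = \sum_(i < n) (u i 0 \*: (fun t : R => hi i (y + t *: s))).
    by apply/funext => r; rewrite fct_sumE.
  apply: is_derive_sum => i; apply: is_deriveZ; apply: is_derive_line.
  by have [] := ddh i.
have [c c01 E] : exists2 c, c \in `]0, 1[%R & phi 1 - phi 0 = dphi c * (1 - 0).
  apply: MVT => //.
  by apply: derivable_within_continuous => t _.
have Hs : enorm (hess h (y + c *: s) *m s) <= kappa * enorm s.
  exact: opbound_le (hk _) (opbound_opnorm _) s.
have dphiE : dphi c = dot u (hess h (y + c *: s) *m s).
  rewrite dotE; apply: eq_bigr => i _; congr (_ * _).
  by rewrite dotE mxE; apply: eq_bigr => k _; rewrite !mxE.
have phiE : phi 1 - phi 0 = dot u u.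
  rewrite dotE /phi -sumrB; apply: eq_bigr => i _.
  have -> : y + 1 *: s = x by rewrite scale1r addrC subrK.
  by rewrite -mulrBr scale0r addr0 /hi !mxE.
have [->|u0] := eqVneq u 0.
  by rewrite /enorm dot0r sqrtr0; apply: le_trans Hs; exact: enorm_ge0.
rewrite -(ler_pM2l (enorm_gt0 u0)) -expr2 enorm_sqr -phiE E subr0 mulr1 dphiE.
apply: (le_trans (dot_le_enorm _ _)); by rewrite ler_wpM2l ?enorm_ge0.
Qed.

End LineDerivatives.

(** * Measurability of the iterates *)

Section MatrixMeasurability.
Context d (T : measurableType d) (R : realType).

(** Nonvanishing of the denominators holds only almost surely, so the inverse is treated on the
    whole line: it is continuous off 0, and {0} is a measurable point. *)
Lemma measurable_invr (h : T -> R) :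
  measurable_fun setT h -> measurable_fun setT (fun w => (h w)^-1).
Proof.
move=> mh; apply: (measurableT_comp (f := @GRing.inv R)) => //.
have -> : [set: R] = ~` [set 0] `|` [set 0] by rewrite setUC setUv.
apply/measurable_funU => //; first exact: measurableC.
split; last exact: measurable_fun_set1.
apply: open_continuous_measurable_fun.
  by apply: closed_openC; exact: closed_eq.
by move=> x; rewrite inE /= => /eqP x0; exact: inv_continuous.
Qed.

(** The source [T] stays arbitrary, so that these lemmas also apply to [Omega] with the
    sigma-algebra generated by some of the samples. *)
Definition measurable_mx a b (A : T -> 'M[R]_(a, b)) :=
  forall i j, measurable_fun setT (fun w => A w i j).

Lemma measurable_mx_cst a b (A : 'M[R]_(a, b)) : measurable_mx (fun=> A).
Proof. by move=> i j; exact: measurable_cst. Qed.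

Lemma measurable_mxD a b (A B : T -> 'M[R]_(a, b)) :
  measurable_mx A -> measurable_mx B -> measurable_mx (fun w => A w + B w).
Proof.
move=> mA mB i j; rewrite (_ : (fun _ => _) = (A ^~ i) ^~ j \+ (B ^~ i) ^~ j).
  exact: measurable_funD.
by apply/funext => w; rewrite mxE.
Qed.

Lemma measurable_mxZ a b (c : T -> R) (A : T -> 'M[R]_(a, b)) :
  measurable_fun setT c -> measurable_mx A -> measurable_mx (fun w => c w *: A w).
Proof.
move=> mc mA i j; rewrite (_ : (fun _ => _) = c \* (A ^~ i) ^~ j).
  exact: measurable_funM.
by apply/funext => w; rewrite mxE.
Qed.

Lemma measurable_mxN a b (A : T -> 'M[R]_(a, b)) :
  measurable_mx A -> measurable_mx (fun w => - A w).
Proof.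
move=> mA; have := measurable_mxZ (measurable_cst (-1 : R)) mA.
by under eq_fun do rewrite scaleN1r.
Qed.

Lemma measurable_mxB a b (A B : T -> 'M[R]_(a, b)) :
  measurable_mx A -> measurable_mx B -> measurable_mx (fun w => A w - B w).
Proof. by move=> mA mB; apply: measurable_mxD => //; exact: measurable_mxN. Qed.

Lemma measurable_mx_sum a b I (s : seq I) (A : I -> T -> 'M[R]_(a, b)) :
  (forall k, measurable_mx (A k)) -> measurable_mx (fun w => \sum_(k <- s) A k w).
Proof.
move=> mA i j.
rewrite (_ : (fun _ => _) = (fun w => \sum_(k <- s) A k w i j)).
  by apply: measurable_sum => k; exact: mA.
by apply/funext => w; rewrite summxE.
Qed.

Lemma measurable_mxM a b c (A : T -> 'M[R]_(a, b)) (B : T -> 'M[R]_(b, c)) :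
  measurable_mx A -> measurable_mx B -> measurable_mx (fun w => A w *m B w).
Proof.
move=> mA mB i j.
rewrite (_ : (fun _ => _) = (fun w => \sum_(k <- index_enum 'I_b) (A w i k * B w k j))).
  by apply: measurable_sum => k; exact: measurable_funM.
by apply/funext => w; rewrite mxE.
Qed.

Lemma measurable_mx_tr a b (A : T -> 'M[R]_(a, b)) :
  measurable_mx A -> measurable_mx (fun w => (A w)^T).
Proof. by move=> mA i j; under eq_fun do rewrite mxE; exact: mA. Qed.

Lemma measurable_mx_scalar a (c : T -> R) :
  measurable_fun setT c -> measurable_mx (fun w => (c w)%:M : 'M[R]_a).
Proof.
move=> mc; under eq_fun do rewrite -scalemx1.
by apply: measurable_mxZ => //; exact: measurable_mx_cst.
Qed.

Lemma measurable_dot a (u v : T -> 'cV[R]_a) :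
  measurable_mx u -> measurable_mx v -> measurable_fun setT (fun w => dot (u w) (v w)).
Proof.
by move=> mu mv; apply: measurable_mxM => //; exact: measurable_mx_tr.
Qed.

Lemma measurable_mx_ball a (X : T -> 'cV[R]_a) (c : 'cV[R]_a) (r : R) :
  0 < r -> measurable_mx X -> measurable [set w | ball c r (X w)].
Proof.
move=> r0 mX.
(* A ball of matrices is an entrywise condition, hence a finite intersection. *)
rewrite [X in measurable X](_ : _ = \bigcap_(i in [set: 'I_a]) \bigcap_(j in [set: 'I_1])
   (setT `&` (fun w => X w i j) @^-1` (ball (c i j) r : set R))).
  apply: fin_bigcap_measurable; first exact: finite_finset.
  move=> i _; apply: fin_bigcap_measurable; first exact: finite_finset.
  by move=> j _; apply: mX => //; exact: measurable_ball.
apply/seteqP; split => w /= => [[_ cX] i _ j _|cX].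
  by split => //; exact: cX.
by split => // i j; have [] := cX i Logic.I j Logic.I.
Qed.

Lemma rational_approx a (u : 'cV[R]_a) (e : R) : 0 < e ->
  exists c : 'cV[rat]_a, ball (map_mx ratr c : 'cV[R]_a) e u.
Proof.
move=> e0.
have rat_near (r : R) : exists s : rat, ball (ratr s : R) e r.
  have /rat_in_itvoo[s] : r < r + e by rewrite ltrDl.
  rewrite in_itv /= => /andP[rs sr]; exists s.
  by rewrite /ball /= ltr_distl sr andbT ltrBlDr; lra.
pose c : 'cV[rat]_a := \col_i projT1 (cid (rat_near (u i 0))).
exists c; split => // i j; rewrite !mxE (ord1 j).
by case: cid.
Qed.

(* An open set of the product is a countable union of boxes with rational
   centres and radii 1 / (k + 1). *)
Lemma measurable_pair_open a b (X : T -> 'cV[R]_a) (Z : T -> 'cV[R]_b)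
    (U : set ('cV[R]_a * 'cV[R]_b)) :
  measurable_mx X -> measurable_mx Z -> open U ->
  measurable [set w | U (X w, Z w)].
Proof.
move=> mX mZ oU.
pose box (t : 'cV[rat]_a * 'cV[rat]_b * nat) : set ('cV[R]_a * 'cV[R]_b) :=
  [set y | ball (map_mx ratr t.1.1 : 'cV[R]_a) (t.2.+1%:R^-1 : R) y.1 /\
           ball (map_mx ratr t.1.2 : 'cV[R]_b) (t.2.+1%:R^-1 : R) y.2].
rewrite [X in measurable X](_ : _ = \bigcup_(t in [set t | box t `<=` U])
   ([set w | ball (map_mx ratr t.1.1 : 'cV[R]_a) (t.2.+1%:R^-1 : R) (X w)] `&`
    [set w | ball (map_mx ratr t.1.2 : 'cV[R]_b) (t.2.+1%:R^-1 : R) (Z w)])).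
  rewrite bigcup_mkcond; apply: countable_bigcupT_measurable => [|t].
    exact: countableP.
  case: ifPn => // _.
  by apply: measurableI; apply: measurable_mx_ball.
apply/seteqP; split => w /=; last by move=> [t tU] wt; exact: tU.
move=> Uw.
have /nbhs_ballP[e /= e0 eU] : nbhs (X w, Z w) U by exact: open_nbhs_nbhs.
(* Half of [e], because the current point and any other point of the box are compared through the
   rational centre. *)
have [k ke] : exists k : nat, k.+1%:R^-1 < e / 2.
  have e20 : 0 < e / 2 by rewrite divr_gt0.
  by have [k _ /(_ k (leqnn k))] := near_infty_natSinv_lt (PosNum e20); exists k.
have r0 : 0 < k.+1%:R^-1 :> R by rewrite invr_gt0.
have [c cX] := rational_approx (X w) r0.
have [c' cZ] := rational_approx (Z w) r0.
exists (c, c', k) => //= y [/= cy c'y]; apply: eU.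
by split => /=; rewrite (splitr e);
  [apply: (@ball_triangle _ _ (map_mx ratr c : 'cV[R]_a))
  |apply: (@ball_triangle _ _ (map_mx ratr c' : 'cV[R]_b))];
  do ?[exact: ball_sym]; apply: le_ball (ltW ke) _ _; do ?[exact: ball_sym].
Qed.

Lemma preimage_borel (U : topologicalType) (h : T -> U) (B : set U) :
  (forall A, open A -> measurable (h @^-1` A)) -> borel B ->
  measurable (h @^-1` B).
Proof.
move=> mh; suff: @borel U `<=` [set A | measurable (h @^-1` A)] by exact.
apply: smallest_sub => //; split => /=.
- by rewrite preimage_set0.
- by move=> A mA; rewrite setTD preimage_setC; exact: measurableC.
- by move=> A mA; rewrite preimage_bigcup; exact: bigcupT_measurable.
Qed.

Lemma measurable_pair_borel a b (X : T -> 'cV[R]_a) (Z : T -> 'cV[R]_b)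
    (h : 'cV[R]_a * 'cV[R]_b -> R) :
  measurable_mx X -> measurable_mx Z -> borel_fun h ->
  measurable_fun setT (fun w => h (X w, Z w)).
Proof.
move=> mX mZ mh; apply: (measurability _ (RGenOpens.measurableE R)) => //.
move=> /= _ [_ [x [y ->]] <-]; rewrite setTI.
apply: (@preimage_borel _ (fun w => (X w, Z w)) (h @^-1` `]x, y[)).
  by move=> A; exact: measurable_pair_open.
by apply: mh; apply: sub_sigma_algebra => /=; exact: interval_open.
Qed.

Lemma measurable_continuous_comp a (X : T -> 'cV[R]_a) (h : 'cV[R]_a -> R) :
  measurable_mx X -> continuous h -> measurable_fun setT (fun w => h (X w)).
Proof.
move=> mX /continuousP ch; apply: (measurability _ (RGenOpens.measurableE R)) => //.
move=> /= _ [_ [x [y ->]] <-]; rewrite setTI.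
(* One variable is reduced to two: [X] is paired with itself and [h] is precomposed with the first
   projection. *)
have /continuousP cfst : continuous (@fst 'cV[R]_a 'cV[R]_a).
  by move=> z; exact: cvg_fst.
apply: (measurable_pair_open mX mX (U := fst @^-1` (h @^-1` `]x, y[))).
by apply: cfst; apply: ch; exact: interval_open.
Qed.

Lemma random_element_measurable_mx a (Z : T -> 'cV[R]_a) :
  random_element Z -> measurable_mx Z.
Proof.
move=> mZ i j; apply: (measurability _ (RGenOpens.measurableE R)) => //.
move=> /= _ [_ [x [y ->]] <-]; rewrite setTI.
apply: (mZ ((fun z : 'cV[R]_a => z i j) @^-1` `]x, y[)).
apply: sub_sigma_algebra => /=.
have /continuousP := @coord_continuous R a 1 i j; apply; exact: interval_open.
Qed.

(** Joint Borel measurability of [F] passes to its partial derivatives, which are pointwise limits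
    of difference quotients with steps 1 / (k + 1). *)
Lemma measurable_grad_l n q (F : 'cV[R]_n -> 'cV[R]_q -> R)
    (X : T -> 'cV[R]_n) (Z : T -> 'cV[R]_q) :
  borel_fun (fun xz : 'cV[R]_n * 'cV[R]_q => F xz.1 xz.2) ->
  (forall z x, differentiable (F ^~ z) x) ->
  measurable_mx X -> measurable_mx Z ->
  measurable_mx (fun w => grad (F ^~ (Z w)) (X w)).
Proof.
move=> mF dF mX mZ i j.
pose e : 'cV[R]_n := delta_mx i 0.
apply: (measurable_fun_cvg (h := fun k w =>
  (k.+1%:R^-1 : R)^-1 * (F (k.+1%:R^-1 *: e + X w) (Z w) - F (X w) (Z w)))).
  move=> k; apply: measurable_funM => //; apply: measurable_funB.
    apply: (measurable_pair_borel (h := fun xz => F xz.1 xz.2)) => //.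
    by apply: measurable_mxD => //; exact: measurable_mx_cst.
  exact: (measurable_pair_borel (h := fun xz => F xz.1 xz.2)).
move=> w _; rewrite /grad mxE.
have /(diff_derivable (v := e)) dFw := dF (Z w) (X w).
have /cvgr_dnbhsP : (fun h => h^-1 *: ((F ^~ (Z w) \o shift (X w)) (h *: e)
    - F (X w) (Z w))) h @[h --> (0 : R)^'] --> 'D_e (F ^~ (Z w)) (X w) := dFw.
apply; split; last exact: cvg_harmonic.
by move=> k; rewrite invr_eq0 pnatr_eq0.
Qed.

End MatrixMeasurability.

Section RunMeasurability.
Context d (T : measurableType d) (R : realType).

Section Updates.
Context (n : nat) (delta : R) (delta_gt0 : 0 < delta) (s y : nat -> T -> 'cV[R]_n).

Lemma measurable_gammaB k :
  measurable_mx (s k.-1) -> measurable_mx (y k.-1) ->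
  measurable_fun setT (fun w => gammaB delta (s ^~ w) (y ^~ w) k).
Proof.
move=> ms my; apply: measurable_maxr => //.
by apply: measurable_funM; [|apply: measurable_invr]; exact: measurable_dot.
Qed.

Lemma measurable_theta j : measurable_mx (s j) -> measurable_mx (y j) ->
  measurable_fun setT (fun w => theta delta (s ^~ w) (y ^~ w) j).
Proof.
move=> ms my; rewrite /theta.
have mc : measurable_fun setT (fun w =>
    dot (s j w) (invmx (Hinit delta (s ^~ w) (y ^~ w) j.+1) *m s j w)).
  under eq_fun do rewrite invmx_Hinit//.
  apply: measurable_dot => //; apply: measurable_mxM => //.
  by apply: measurable_mx_scalar; exact: measurable_gammaB.
have msy : measurable_fun setT (fun w => dot (s j w) (y j w)).
  exact: measurable_dot.
apply: measurable_fun_ifT => //.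
  by apply: measurable_fun_ltr => //; exact: measurable_funM.
apply: measurable_funM; first exact: measurable_funM.
by apply: measurable_invr; exact: measurable_funB.
Qed.

Lemma measurable_ybar j : measurable_mx (s j) -> measurable_mx (y j) ->
  measurable_mx (fun w => ybar delta (s ^~ w) (y ^~ w) j).
Proof.
move=> ms my; have mt := measurable_theta ms my.
apply: measurable_mxD; apply: measurable_mxZ => //; first exact: measurable_funB.
under eq_fun do rewrite invmx_Hinit//.
apply: measurable_mxM => //.
by apply: measurable_mx_scalar; exact: measurable_gammaB.
Qed.

Lemma measurable_bfgs_update (H : T -> 'M[R]_n) (u v : T -> 'cV[R]_n) :
  measurable_mx H -> measurable_mx u -> measurable_mx v ->
  measurable_mx (fun w => bfgs_update (H w) (u w) (v w)).
Proof.
move=> mH mu mv.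
have mr : measurable_fun setT (fun w => (dot (u w) (v w))^-1).
  by apply: measurable_invr; exact: measurable_dot.
have rank1 (a b : T -> 'cV[R]_n) : measurable_mx a -> measurable_mx b ->
    measurable_mx (fun w => (dot (u w) (v w))^-1 *: (a w *m (b w)^T)).
  move=> ma mb; apply: measurable_mxZ => //.
  by apply: measurable_mxM => //; exact: measurable_mx_tr.
apply: measurable_mxD; last exact: rank1.
apply: measurable_mxM; [apply: measurable_mxM => //|];
  by apply: measurable_mxB; [exact: measurable_mx_cst|exact: rank1].
Qed.

Lemma measurable_Hrec r k i : (2 <= k)%N -> (i <= r < k)%N ->
  (forall j, (1 <= j < k)%N -> measurable_mx (s j) /\ measurable_mx (y j)) ->
  measurable_mx (fun w => Hrec delta (s ^~ w) (y ^~ w) r k i).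
Proof.
move=> k2 + msy; elim: i => [|i IHi] irk /=.
  have [] := msy k.-1; first by lia.
  move=> ms my; apply: measurable_mx_scalar; apply: measurable_invr.
  exact: measurable_gammaB.
have [] := msy (k - (r - i.+1 + 1))%N; first by lia.
move=> ms my; apply: measurable_bfgs_update => //; last exact: measurable_ybar.
by apply: IHi; lia.
Qed.

Lemma measurable_SdLBFGS p k : (2 <= k)%N ->
  (forall j, (1 <= j < k)%N -> measurable_mx (s j) /\ measurable_mx (y j)) ->
  measurable_mx (fun w => SdLBFGS delta p (s ^~ w) (y ^~ w) k).
Proof.
by move=> k2 msy; apply: measurable_Hrec => //; rewrite leqnn; lia.
Qed.

End Updates.

(** This makes precise that [x j] and [H j], for [j <= k], are functions of the batches before [k]:
    [T] may carry any sigma-algebra for which those batches are measurable. *)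
Lemma measurable_run (n q : nat) (F : 'cV[R]_n -> 'cV[R]_q -> R)
    (g : 'cV[R]_n -> 'cV[R]_q -> 'cV[R]_n) (kappa delta : R)
    (m : nat -> nat) (alpha : nat -> R) (p N : nat) (x1 : 'cV[R]_n)
    (H1 : 'M[R]_n) (xi : nat -> nat -> T -> 'cV[R]_q) (x : nat -> T -> 'cV[R]_n)
    (H : nat -> T -> 'M[R]_n) (k : nat) :
  borel_fun (fun xz : 'cV[R]_n * 'cV[R]_q => F xz.1 xz.2) ->
  0 < delta -> smooth_samples F g kappa ->
  (forall w, sqn_run g m alpha delta p x1 H1 N
     (fun k i => xi k i w) (x ^~ w) (H ^~ w)) ->
  (k <= N.+1)%N ->
  (forall j i, (1 <= j < k)%N -> (i < m j)%N -> measurable_mx (xi j i)) ->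
  forall j, (1 <= j <= k)%N ->
    measurable_mx (x j) /\ ((j <= N)%N -> measurable_mx (H j)).
Proof.
move=> mF delta0 [Fdiff gE _] run.
have mg (X : T -> 'cV[R]_n) (Z : T -> 'cV[R]_q) :
    measurable_mx X -> measurable_mx Z -> measurable_mx (fun w => g (X w) (Z w)).
  move=> mX mZ; under eq_fun do rewrite gE; apply: measurable_grad_l => //.
  by move=> z u; have [[]] := Fdiff z.
elim: k => [|k IHk] kN mxi j /andP[j1 jk]; first by lia.
move: jk; rewrite leq_eqVlt => /predU1P[->{j j1}|jk]; last first.
  by apply: (IHk (ltnW kN)) => [j' i jk'|]; [apply: mxi|]; lia.
have {}IHk j : (1 <= j <= k)%N ->
    measurable_mx (x j) /\ ((j <= N)%N -> measurable_mx (H j)).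
  by apply: (IHk (ltnW kN)) => j' i jk'; apply: mxi; lia.
have [->|k0] := posnP k.
  rewrite (_ : x 1%N = fun=> x1); last by apply/funext => w; have [] := run w.
  rewrite (_ : H 1%N = fun=> H1); last by apply/funext => w; have [] := run w.
  by split => [|_]; exact: measurable_mx_cst.
(* The iterate comes before the matrix: [H k.+1] uses s_k and y_k, hence [x k.+1]. *)
have mx j : (1 <= j <= k.+1)%N -> measurable_mx (x j).
  move=> /andP[j1]; rewrite leq_eqVlt => /predU1P[->|jk]; last first.
    by have [] := IHk j (introT andP (conj j1 jk)).
  have [|mxk mHk] := IHk k; first by rewrite k0 leqnn.
  rewrite (_ : x k.+1 = fun w => x k w - alpha k *:
      (H k w *m stoch_grad g m (x ^~ w) (fun k i => xi k i w) k)); last first.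
    by apply/funext => w; have [_ _ _ ->//] := run w; rewrite k0.
  apply: measurable_mxB => //; apply: measurable_mxZ => //.
  apply: measurable_mxM; first exact: mHk.
  apply: measurable_mxZ => //; apply: measurable_mx_sum => i.
  by apply: mg; [exact: mxk|apply: mxi; [lia|exact: ltn_ord]].
split=> [|kN']; first by apply: mx; lia.
rewrite (_ : H k.+1 = fun w => SdLBFGS delta p (sdiff (x ^~ w))
    (ydiff g m (x ^~ w) (fun k i => xi k i w)) k.+1); last first.
  by apply/funext => w; have [_ _ ->//] := run w; rewrite ltnS k0.
apply: (@measurable_SdLBFGS _ _ delta0 (fun j w => sdiff (x ^~ w) j)
  (fun j w => ydiff g m (x ^~ w) (fun k i => xi k i w) j)) => // j jk.
split.
  by apply: measurable_mxB; apply: mx; lia.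
apply: measurable_mxZ => //; apply: measurable_mx_sum => i.
by apply: measurable_mxB; (apply: mg; [apply: mx; lia|]); apply: mxi;
  [lia|exact: ltn_ord|lia|exact: ltn_ord].
Qed.

End RunMeasurability.

(** * Integrable and square-integrable random vectors *)

Section AlmostSureBounds.
Context d (Omega : measurableType d) (R : realType) (P : probability Omega R).
Implicit Types (h k : Omega -> R).

Local Notation L1 h := (P.-integrable setT (EFin \o h)).
Local Notation Ex h := (Rintegral P setT h).

Lemma L1_ae_bound h k : measurable_fun setT h -> L1 k ->
  {ae P, forall w, `|h w| <= k w} -> L1 h.
Proof.
move=> mh /integrableP[/measurable_EFinP mk kfin] hk; apply/integrableP; split.
  exact/measurable_EFinP.
apply: le_lt_trans kfin; apply: ae_ge0_le_integral => //.
- by apply: measurableT_comp => //; exact/measurable_EFinP.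
- by apply: measurableT_comp => //; exact/measurable_EFinP.
- apply: filterS hk => w hkw _ /=; rewrite lee_fin.
  exact: le_trans hkw (ler_norm _).
Qed.

Lemma L1_measurable h : L1 h -> measurable_fun setT h.
Proof. by case/integrableP => /measurable_EFinP. Qed.

Lemma L1D h k : L1 h -> L1 k -> L1 (fun w => h w + k w).
Proof. by move=> ih ik; have := integrableD measurableT ih ik. Qed.

Lemma L1Z (c : R) h : L1 h -> L1 (fun w => c * h w).
Proof. by move=> ih; have := integrableZl measurableT c ih. Qed.

Lemma L1N h : L1 h -> L1 (fun w => - h w).
Proof. by move=> ih; have := integrableN ih. Qed.

Lemma L1B h k : L1 h -> L1 k -> L1 (fun w => h w - k w).
Proof. by move=> ih ik; apply: L1D => //; exact: L1N. Qed.

Lemma L1_cst (c : R) : L1 (fun=> c).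
Proof. exact: finite_measure_integrable_cst. Qed.

Lemma Ex_cst (c : R) : Ex (fun=> c) = c.
Proof.
apply: (etrans (Rintegral_cst P measurableT c)); rewrite -[RHS]mulr1.
by congr (_ * _); exact: (congr1 fine (probability_setT P)).
Qed.

Lemma ae_le_Ex h k : L1 h -> L1 k -> {ae P, forall w, h w <= k w} ->
  Ex h <= Ex k.
Proof.
(* Monotonicity is available for pointwise inequalities; the minimum agrees with [h] almost
   everywhere and is below [k] everywhere. *)
move=> ih ik hk; pose l w := Num.min (h w) (k w).
have ml : measurable_fun setT l by apply: measurable_minr; exact: L1_measurable.
have hl : {ae P, forall w, setT w -> (EFin \o h) w = (EFin \o l) w}.
  by apply: filterS hk => w hkw _; rewrite /l /= min_l.
have -> : Ex h = Ex l.
  congr fine; apply: ae_eq_integral => //; apply/measurable_EFinP => //.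
  exact: L1_measurable.
apply: le_Rintegral => //.
  have : L1 (fun w => `|h w|) by exact: integrable_abse ih.
  move=> iah; apply: (L1_ae_bound ml iah).
  by apply: filterS hl => w /(_ Logic.I) /= [->].
by move=> w _; rewrite ge_min lexx orbT.
Qed.

Lemma L1_sum I (s : seq I) (F : I -> Omega -> R) :
  (forall i, L1 (F i)) -> L1 (fun w => \sum_(i <- s) F i w).
Proof.
move=> iF; elim: s => [|i s IHs].
  by under eq_fun do rewrite /= big_nil; exact: L1_cst.
by under eq_fun do rewrite /= big_cons; exact: L1D.
Qed.

Lemma Ex_sum I (s : seq I) (F : I -> Omega -> R) :
  (forall i, L1 (F i)) ->
  Ex (fun w => \sum_(i <- s) F i w) = \sum_(i <- s) Ex (F i).
Proof.
move=> iF; elim: s => [|i s IHs].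
  by under eq_Rintegral do rewrite big_nil; rewrite Ex_cst big_nil.
under eq_Rintegral do rewrite big_cons.
by rewrite RintegralD// ?IHs ?big_cons//; exact: L1_sum.
Qed.

End AlmostSureBounds.

Section SquareIntegrable.
Context d (Omega : measurableType d) (R : realType) (P : probability Omega R).
Context (n : nat).
Implicit Types (u v : Omega -> 'cV[R]_n).

Local Notation L1 h := (P.-integrable setT (EFin \o h)).

Definition L2 u := measurable_mx u /\ L1 (fun w => enorm (u w) ^+ 2).

Lemma measurable_enorm2 d' (T : measurableType d') (u : T -> 'cV[R]_n) :
  measurable_mx u -> measurable_fun setT (fun w => enorm (u w) ^+ 2).
Proof. by move=> mu; under eq_fun do rewrite enorm_sqr; exact: measurable_dot. Qed.

Lemma L2_ae_bound u (k : Omega -> R) : measurable_mx u -> L1 k ->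
  {ae P, forall w, enorm (u w) ^+ 2 <= k w} -> L2 u.
Proof.
move=> mu ik uk; split=> //; apply: (L1_ae_bound (measurable_enorm2 mu) ik).
by apply: filterS uk => w uw; rewrite ger0_norm// sqr_ge0.
Qed.

Lemma L2_cst (a : 'cV[R]_n) : L2 (fun=> a).
Proof. by split; [exact: measurable_mx_cst|exact: L1_cst]. Qed.

Lemma enormD_sqr (a b : 'cV[R]_n) :
  enorm (a + b) ^+ 2 <= 2 * (enorm a ^+ 2 + enorm b ^+ 2).
Proof.
have ab : enorm (a + b) ^+ 2 <= (enorm a + enorm b) ^+ 2.
  by rewrite ler_pXn2r ?nnegrE ?addr_ge0 ?enorm_ge0// enormD.
by apply: (le_trans ab); have := sqr_ge0 (enorm a - enorm b); lra.
Qed.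

Lemma L2D u v : L2 u -> L2 v -> L2 (fun w => u w + v w).
Proof.
move=> [mu iu] [mv iv]; apply: (L2_ae_bound (measurable_mxD mu mv)
  (L1Z 2 (L1D iu iv))).
by apply: nearW => w; exact: enormD_sqr.
Qed.

Lemma L2Z (c : R) u : L2 u -> L2 (fun w => c *: u w).
Proof.
move=> [mu iu]; apply: (L2_ae_bound _ (L1Z (c ^+ 2) iu)).
  exact: measurable_mxZ.
by apply: nearW => w; rewrite enormZ exprMn real_normK// num_real.
Qed.

Lemma L2_sum I (s : seq I) (F : I -> Omega -> 'cV[R]_n) :
  (forall i, L2 (F i)) -> L2 (fun w => \sum_(i <- s) F i w).
Proof.
move=> iF; elim: s => [|i s IHs].
  by under eq_fun do rewrite big_nil; exact: L2_cst.
by under eq_fun do rewrite big_cons; exact: L2D.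
Qed.

Lemma L2_dot u v : L2 u -> L2 v -> L1 (fun w => dot (u w) (v w)).
Proof.
move=> [mu iu] [mv iv]; apply: (L1_ae_bound (measurable_dot mu mv) (L1D iu iv)).
apply: nearW => w; apply: (le_trans (cauchy_schwarz _ _)).
by have := sqr_ge0 (enorm (u w) - enorm (v w));
  have := sqr_ge0 (enorm (u w)); have := sqr_ge0 (enorm (v w)); lra.
Qed.

Lemma L2_mulmx (A : Omega -> 'M[R]_n) (c : R) u : measurable_mx A ->
  {ae P, forall w, opbound (A w) c} -> L2 u -> L2 (fun w => A w *m u w).
Proof.
move=> mA Ac [mu iu]; apply: (L2_ae_bound _ (L1Z (c ^+ 2) iu)).
  exact: measurable_mxM.
apply: filterS Ac => w Aw; rewrite -exprMn ler_pXn2r ?nnegrE ?enorm_ge0//.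
exact: le_trans (enorm_ge0 _) (Aw _).
Qed.

End SquareIntegrable.

(** * Decoupling for two independent generated sigma-algebras *)

Section SigmaAlgebraDecoupling.
Context d (Omega : measurableType d) (R : realType) (P : probability Omega R).
Context (G1 G2 : set (set Omega)).
Hypotheses (mG1 : G1 `<=` measurable) (mG2 : G2 `<=` measurable)
  (indG : indep_classes P <<s G1 >> <<s G2 >>).

Let T1 := g_sigma_algebraType G1.
Let T2 := g_sigma_algebraType G2.

(* The identity, seen as a map onto Omega with the coarser sigma-algebra <<s G>>:
   decoupling is applied to the pair of these maps for two independent classes,
   that is, along the diagonal of Omega * Omega. *)
Definition to_generated (G : set (set Omega)) (w : Omega) :
  g_sigma_algebraType G := w.

Lemma measurable_to_generated (G : set (set Omega)) : G `<=` measurable ->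
  measurable_fun setT (to_generated G).
Proof.
move=> mG _ A GA; rewrite setTI.
suff: <<s G >> `<=` @measurable _ Omega by exact.
by apply: smallest_sub => //; exact: sigma_algebra_measurable.
Qed.

Lemma ge0_decoupling_generated (h : T1 * T2 -> \bar R) (c : R) :
  0 <= c -> measurable_fun [set: T1 * T2] h -> (forall z, 0 <= h z)%E ->
  {ae P, forall w, (\int[P]_w' h (w, w') <= c%:E)%E} ->
  (\int[P]_w h (w, w) <= c%:E)%E.
Proof.
exact: (ge0_decoupling_le (measurable_to_generated mG1)
  (measurable_to_generated mG2) indG).
Qed.

Lemma decoupling0_generated (h : T1 * T2 -> \bar R) :
  measurable_fun [set: T1 * T2] h -> P.-integrable setT (fun w => h (w, w)) ->
  {ae P, forall w, (\int[P]_w' h (w, w') = 0)%E} ->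
  (\int[P]_w h (w, w) = 0)%E.
Proof.
exact: (decoupling0 (measurable_to_generated mG1)
  (measurable_to_generated mG2) indG).
Qed.

End SigmaAlgebraDecoupling.

(** * One-step descent for a single realization *)

Section Descent.
Context (R : realType) (n : nat).

(** From |A^T v|^2 = v^T A A^T v <= |v| c |A^T v|. The transpose appears because the cross term is
    rewritten with [H k] acting on the gradient, which leaves the noise alone in the other
    argument. *)
Lemma opbound_tr (A : 'M[R]_n) c : opbound A c -> opbound A^T c.
Proof.
move=> Ac v; have [Av0|Av0] := eqVneq (A^T *m v) 0.
  rewrite Av0 /enorm dot0r sqrtr0; exact: le_trans (enorm_ge0 _) (Ac v).
rewrite -(ler_pM2l (enorm_gt0 Av0)) -expr2 enorm_sqr dot_mulmxr trmxK.
apply: (le_trans (dot_le_enorm _ _)).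
apply: (le_trans (ler_wpM2r (enorm_ge0 _) (Ac _))).
by rewrite -mulrA mulrCA mulrA mulrAC (mulrC _ c).
Qed.

(** The terms linear in the noise [e] are kept as inner products rather than estimated, since they
    vanish in expectation. The square of the gradient from the quadratic term merges with [a * klo]
    into [index_weight]. *)
Lemma sqn_step_descent (f : 'cV[R]_n -> R) (flow L klo kup a : R)
    (A : 'M[R]_n) (u e : 'cV[R]_n) :
  smooth_objective f flow L -> 0 <= L -> 0 <= a ->
  opbound A kup -> loewner_le klo%:M A ->
  f (u - a *: (A *m (grad f u + e))) <=
    f u - index_weight klo kup L a * enorm (grad f u) ^+ 2
    - a * dot (A^T *m grad f u) e
    + (L * a ^+ 2 * kup ^+ 2) * dot (grad f u) e
    + (L / 2 * a ^+ 2 * kup ^+ 2) * enorm e ^+ 2.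
Proof.
move=> [[df _] _ Lf] L0 a0 Aup [_ Alow].
apply: (le_trans (descent_lemma u _ df Lf)).
rewrite enormN enormZ dotNr dotZr mulmxDr dotDr [dot _ (A *m e)]dot_mulmxr.
have low : klo * enorm (grad f u) ^+ 2 <= dot (grad f u) (A *m grad f u).
  have := Alow (grad f u).
  by rewrite mulmxBl dotBr mul_scalar_mx dotZr subr_ge0 enorm_sqr.
have up : enorm (A *m grad f u + A *m e) ^+ 2 <=
    kup ^+ 2 * (enorm (grad f u) ^+ 2 + 2 * dot (grad f u) e + enorm e ^+ 2).
  have := Aup (grad f u + e); rewrite mulmxDr => Ae.
  have -> : enorm (grad f u) ^+ 2 + 2 * dot (grad f u) e + enorm e ^+ 2 =
      enorm (grad f u + e) ^+ 2.
    by rewrite !enorm_sqr dotDl !dotDr (dotC e); ring.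
  rewrite -exprMn ler_pXn2r ?nnegrE ?enorm_ge0//.
  exact: le_trans (enorm_ge0 _) Ae.
rewrite exprMn ger0_norm// /index_weight.
have := ler_wpM2l a0 low.
have La0 : 0 <= L / 2 * a ^+ 2 by rewrite mulr_ge0 ?sqr_ge0// divr_ge0.
have := ler_wpM2l La0 up.
lra.
Qed.

End Descent.

(** * Expected descent of SQN *)

Section Sampling.
Context d (Omega : measurableType d) (R : realType) (P : probability Omega R).
Context (n q : nat) (F : 'cV[R]_n -> 'cV[R]_q -> R)
  (g : 'cV[R]_n -> 'cV[R]_q -> 'cV[R]_n) (f : 'cV[R]_n -> R).
Context (flow L sigma kappa delta : R) (p N : nat) (m : nat -> nat)
  (alpha : nat -> R) (x1 : 'cV[R]_n) (H1 : 'M[R]_n)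
  (xi : nat -> nat -> Omega -> 'cV[R]_q)
  (x : nat -> Omega -> 'cV[R]_n) (H : nat -> Omega -> 'M[R]_n).
Hypotheses
  (F_borel : borel_fun (fun xz : 'cV[R]_n * 'cV[R]_q => F xz.1 xz.2))
  (delta_gt0 : 0 < delta)
  (xi_rv : forall k i, (1 <= k <= N)%N -> (i < m k)%N -> random_element (xi k i))
  (run : forall w, sqn_run g m alpha delta p x1 H1 N
     (fun k i => xi k i w) (x ^~ w) (H ^~ w))
  (AS1 : smooth_objective f flow L)
  (AS2 : stochastic_oracle P f g sigma m N x xi)
  (AS5 : smooth_samples F g kappa).

Let X (ki : nat * nat) := xi ki.1 ki.2.

Local Notation L1 h := (P.-integrable setT (EFin \o h)).
Local Notation Ex h := (Rintegral P setT h).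

(** The generators of [sigma_of D X], named because [g_sigma_algebraType] is built from
    generators. *)
Definition sample_events (D : set (nat * nat)) : set (set Omega) :=
  \bigcup_(ki in D) [set X ki @^-1` B | B in @borel 'cV[R]_q].

Lemma sample_events_measurable D : D `<=` in_batch m N ->
  sample_events D `<=` measurable.
Proof.
by move=> Dm _ [ki /Dm[kN im]] [B mB <-]; exact: (xi_rv kN im).
Qed.

Lemma measurable_sample D ki : D ki ->
  @measurable_mx _ (g_sigma_algebraType (sample_events D)) R _ _ (X ki).
Proof.
move=> Dki; apply: random_element_measurable_mx => B mB.
by apply: sub_sigma_algebra; exists ki => //; exists B.
Qed.

Lemma measurable_oracle d' (T : measurableType d') (Y : T -> 'cV[R]_n)
    (Z : T -> 'cV[R]_q) :
  measurable_mx Y -> measurable_mx Z -> measurable_mx (fun w => g (Y w) (Z w)).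
Proof.
move=> mY mZ; have [Fdiff gE _] := AS5; under eq_fun do rewrite gE.
by apply: measurable_grad_l => // z u; have [[]] := Fdiff z.
Qed.

Lemma measurable_grad_f d' (T : measurableType d') (Y : T -> 'cV[R]_n) :
  measurable_mx Y -> measurable_mx (fun w => grad f (Y w)).
Proof.
move=> mY i j; have [[_ cf] _ _] := AS1.
apply: (measurable_continuous_comp (h := fun u => grad f u i j)) => // u.
exact: (continuous_comp (cf u) (@coord_continuous R n 1 i j (grad f u))).
Qed.

Lemma measurable_iterate D k : (k <= N.+1)%N ->
  (forall j i, (1 <= j < k)%N -> (i < m j)%N -> D (j, i)) ->
  forall j, (1 <= j <= k)%N ->
    @measurable_mx _ (g_sigma_algebraType (sample_events D)) R _ _ (x j) /\
    ((j <= N)%N ->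
      @measurable_mx _ (g_sigma_algebraType (sample_events D)) R _ _ (H j)).
Proof.
move=> kN Dji; apply: (measurable_run (T := g_sigma_algebraType (sample_events D))
  F_borel delta_gt0 AS5 run kN) => j i jk im.
exact: (measurable_sample (Dji _ _ jk im)).
Qed.

Definition other_samples k i : set (nat * nat) := in_batch m N `\ (k, i).

Lemma other_samples_sub k i : other_samples k i `<=` in_batch m N.
Proof. by move=> ? []. Qed.

Lemma indep_sample k i : in_batch m N (k, i) ->
  indep_classes P <<s sample_events (other_samples k i) >>
                  <<s sample_events [set (k, i)] >>.
Proof.
move=> ki; have [mind _ _] := AS2.
have Xrv ki' : in_batch m N ki' -> random_element (X ki').
  by case: ki' => k' i' [/= kN im]; exact: xi_rv.
apply: (mutual_indep_disjoint Xrv mind (@other_samples_sub k i)).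
- by move=> _ ->.
- by rewrite /other_samples setDE -setIA setICl setI0.
Qed.

Lemma measurable_iterate_other k i j : (k <= N)%N -> (1 <= j <= k)%N ->
  @measurable_mx _ (g_sigma_algebraType (sample_events (other_samples k i))) R _ _ (x j) /\
  @measurable_mx _ (g_sigma_algebraType (sample_events (other_samples k i))) R _ _ (H j).
Proof.
move=> kN jk; have [] := @measurable_iterate (other_samples k i) k _ _ j jk.
- exact: leqW.
- move=> j' i' jk' im'; split => /=; first by split => //=; lia.
  (* The iterates up to [k] use batches strictly before [k], so the excluded sample is never among
     them. *)
  by case=> jk'' _; move: jk'; rewrite jk'' ltnn andbF.
- by move=> mx mH; split => //; apply: mH; lia.
Qed.

Definition noise k i w := g (x k w) (xi k i w) - grad f (x k w).

(** On the diagonal this is [noise k i]; integrated over [z.2] with [z.1] fixed, it is the quantity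
    that the oracle hypothesis controls. *)
Definition decoupled_noise k i (z : Omega * Omega) :=
  g (x k z.1) (xi k i z.2) - grad f (x k z.1).

Lemma measurable_decoupled_noise k i : in_batch m N (k, i) ->
  @measurable_mx _ (g_sigma_algebraType (sample_events (other_samples k i)) *
    g_sigma_algebraType (sample_events [set (k, i)]))%type R _ _ (decoupled_noise k i).
Proof.
move=> [/= /andP[k1 kN] im].
have [mxk _] := @measurable_iterate_other k i k kN (introT andP (conj k1 (leqnn k))).
have mxk1 : @measurable_mx _ (g_sigma_algebraType (sample_events (other_samples k i)) *
    g_sigma_algebraType (sample_events [set (k, i)]))%type R _ _ (fun z => x k z.1).
  by move=> a b; exact: (measurableT_comp (mxk a b) measurable_fst).
have mxi : @measurable_mx _ (g_sigma_algebraType (sample_events (other_samples k i)) *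
    g_sigma_algebraType (sample_events [set (k, i)]))%type R _ _ (fun z => xi k i z.2).
  move=> a b; have mX := @measurable_sample [set (k, i)] (k, i) erefl a b.
  exact: (measurableT_comp mX measurable_snd).
apply: measurable_mxB; first exact: measurable_oracle.
exact: measurable_grad_f.
Qed.

Lemma measurable_iterate_Omega j : (1 <= j <= N.+1)%N ->
  measurable_mx (x j) /\ ((j <= N)%N -> measurable_mx (H j)).
Proof.
apply: (measurable_run F_borel delta_gt0 AS5 run (leqnn N.+1)) => k i kN im.
by apply: random_element_measurable_mx; apply: xi_rv => //; lia.
Qed.

Lemma measurable_noise k i : in_batch m N (k, i) -> measurable_mx (noise k i).
Proof.
move=> [/= /andP[k1 kN] im].
have [mxk _] := @measurable_iterate_Omega k (introT andP (conj k1 (leqW kN))).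
have mxi : measurable_mx (xi k i).
  by apply: random_element_measurable_mx; apply: xi_rv => //; rewrite k1.
by apply: measurable_mxB; [exact: measurable_oracle|exact: measurable_grad_f].
Qed.

Lemma noise_second_moment k i : in_batch m N (k, i) ->
  (\int[P]_w (enorm (noise k i w) ^+ 2)%:E <= (sigma ^+ 2)%:E)%E.
Proof.
move=> ki; have [/= kN im] := ki; have [_ _ /(_ _ _ kN im) orc] := AS2.
apply: (ge0_decoupling_generated
  (sample_events_measurable (@other_samples_sub k i))
  (sample_events_measurable (D := [set (k, i)]) _) (indep_sample ki)
  (h := fun z => (enorm (decoupled_noise k i z) ^+ 2)%:E)) => //.
- by move=> _ ->.
- exact: sqr_ge0.
- apply/measurable_EFinP; apply: measurable_enorm2.
  exact: measurable_decoupled_noise.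
- by move=> z; rewrite lee_fin sqr_ge0.
- by apply: filterS orc => w [_]; rewrite expectation.unlock.
Qed.

Lemma noise_L2 k i : in_batch m N (k, i) -> L2 P (noise k i).
Proof.
move=> ki; have mn := measurable_noise ki; split => //.
apply/integrableP; split; first exact/measurable_EFinP/measurable_enorm2.
under eq_integral do rewrite /= ger0_norm ?sqr_ge0//.
by rewrite (le_lt_trans (noise_second_moment ki))// ltry.
Qed.

Lemma Ex_noise_le k i : in_batch m N (k, i) ->
  Ex (fun w => enorm (noise k i w) ^+ 2) <= sigma ^+ 2.
Proof.
move=> ki; have [_ in2] := noise_L2 ki.
rewrite -lee_fin fineK; first exact: noise_second_moment.
exact: integrable_fin_num in2.
Qed.

(* V may depend on every sample but xi k i, in particular on the other samples
   of batch k; this covers both H_k grad f (x_k) and the cross terms of the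
   variance of the batch mean. *)
Lemma noise_orthogonal k i (V : Omega -> 'cV[R]_n) : in_batch m N (k, i) ->
  @measurable_mx _ (g_sigma_algebraType (sample_events (other_samples k i))) R _ _ V ->
  L2 P V -> Ex (fun w => dot (V w) (noise k i w)) = 0.
Proof.
move=> ki mV V2; have [/= kN im] := ki; have [_ _ /(_ _ _ kN im) orc] := AS2.
rewrite /Rintegral.
suff -> : (\int[P]_w (dot (V w) (noise k i w))%:E = 0)%E by [].
apply: (decoupling0_generated
  (sample_events_measurable (@other_samples_sub k i))
  (sample_events_measurable (D := [set (k, i)]) _) (indep_sample ki)
  (h := fun z => (dot (V z.1) (decoupled_noise k i z))%:E)) => //.
- by move=> _ ->.
- apply/measurable_EFinP; apply: measurable_dot.
    by move=> a b; exact: (measurableT_comp (mV a b) measurable_fst).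
  exact: measurable_decoupled_noise.
- exact: (L2_dot V2 (noise_L2 ki)).
- apply: filterS orc => w [orc _] /=.
  (* With [w] frozen, [V w] is constant, and the inner integral reduces to the zero mean of each
     coordinate of the noise. *)
  have e0 l : L1 (fun w' => decoupled_noise k i (w, w') l 0) /\
      (\int[P]_w' (decoupled_noise k i (w, w') l 0)%:E = 0)%E.
    have [ig]:= orc l; rewrite expectation.unlock => Eg.
    rewrite /decoupled_noise /=.
    have eE w' : (g (x k w) (xi k i w') - grad f (x k w)) l 0 =
        g (x k w) (xi k i w') l 0 - grad f (x k w) l 0 by rewrite 2!mxE.
    split; first by under eq_fun do rewrite /= eE; exact: (L1B ig (L1_cst P _)).
    under eq_integral do rewrite eE EFinB.
    rewrite integralB_EFin//; last exact: L1_cst.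
    rewrite Eg integral_cst// [X in (_ - _ * X)%E](_ : _ = 1%E).
      by rewrite mule1 subee.
    exact: probability_setT.
  pose c l : R := V w l 0.
  under eq_integral do rewrite dotE -sumEFin.
  have ie l : P.-integrable setT (fun w' =>
      (c l * decoupled_noise k i (w, w') l 0)%:E).
    exact: L1Z (e0 l).1.
  rewrite (integral_sum _ _ (f := fun l w' =>
      (c l * decoupled_noise k i (w, w') l 0)%:E))// big1// => l _.
  under eq_integral do rewrite EFinM.
  by rewrite integralZl ?(e0 l).2 ?mule0//; exact: (e0 l).1.
Qed.

Definition batch_noise k w :=
  stoch_grad g m (x ^~ w) (fun k i => xi k i w) k - grad f (x k w).

Lemma batch_noiseE k w : (0 < m k)%N ->
  batch_noise k w = (m k)%:R^-1 *: \sum_(i < m k) noise k i w.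
Proof.
move=> mk0; rewrite /batch_noise /stoch_grad /noise sumrB scalerBr; congr (_ - _).
rewrite sumr_const card_ord -[X in _ *: X]scaler_nat scalerA mulVf ?scale1r//.
by rewrite pnatr_eq0 -lt0n.
Qed.

Lemma batch_noise_L2 k : (1 <= k <= N)%N -> (0 < m k)%N -> L2 P (batch_noise k).
Proof.
move=> kN mk0; rewrite (_ : batch_noise k = fun w => (m k)%:R^-1 *:
    \sum_(i < m k) noise k i w); last first.
  by apply/funext => w; exact: batch_noiseE.
by apply: L2Z; apply: L2_sum => i; apply: noise_L2; split => /=.
Qed.

Lemma batch_noise_orthogonal k (V : Omega -> 'cV[R]_n) :
  (1 <= k <= N)%N -> (0 < m k)%N ->
  (forall i, (i < m k)%N ->
    @measurable_mx _ (g_sigma_algebraType (sample_events (other_samples k i))) R _ _ V) ->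
  L2 P V -> Ex (fun w => dot (V w) (batch_noise k w)) = 0.
Proof.
move=> kN mk0 mV V2.
have ki (i : 'I_(m k)) : in_batch m N (k, i : nat) by split => /=.
under eq_Rintegral do rewrite batch_noiseE// dotZr dot_sumr.
have iV (i : 'I_(m k)) : L1 (fun w => dot (V w) (noise k i w)).
  exact: L2_dot V2 (noise_L2 (ki i)).
rewrite RintegralZl//; last exact: L1_sum.
rewrite Ex_sum// big1 ?mulr0// => i _.
exact: noise_orthogonal (ki i) (mV i (ltn_ord i)) V2.
Qed.

Lemma Ex_batch_noise_le k : (1 <= k <= N)%N -> (0 < m k)%N ->
  Ex (fun w => enorm (batch_noise k w) ^+ 2) <= sigma ^+ 2 / (m k)%:R.
Proof.
move=> kN mk0.
have ki (i : 'I_(m k)) : in_batch m N (k, i : nat) by split => /=.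
have iee (i j : 'I_(m k)) : L1 (fun w => dot (noise k i w) (noise k j w)).
  exact: L2_dot (noise_L2 (ki i)) (noise_L2 (ki j)).
have expand w : enorm (batch_noise k w) ^+ 2 = (m k)%:R^-1 ^+ 2 *
    \sum_(j < m k) \sum_(i < m k) dot (noise k i w) (noise k j w).
  rewrite enorm_sqr batch_noiseE// dotZl dotZr mulrA -expr2 dot_sumr; congr (_ * _).
  by apply: eq_bigr => j _; rewrite dotC dot_sumr; apply: eq_bigr => i _; rewrite dotC.
under eq_Rintegral do rewrite expand.
rewrite RintegralZl//; last by apply: L1_sum => j; exact: L1_sum.
rewrite Ex_sum; last by move=> j; exact: L1_sum.
have diag (j : 'I_(m k)) :
    Ex (fun w => \sum_(i < m k) dot (noise k i w) (noise k j w)) <= sigma ^+ 2.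
  rewrite Ex_sum// (bigD1 j)//= big1 ?addr0 => [|i ij].
    under eq_Rintegral do rewrite -enorm_sqr.
    exact: Ex_noise_le.
  (* For i different from j, the noise of sample [i] is a function of [x k] and [xi k i], hence of
     the samples other than (k, j). *)
  apply: noise_orthogonal (ki j) _ (noise_L2 (ki i)).
  have /andP[k1 kN'] := kN.
  have [mxk _] := @measurable_iterate_other k j k kN' (introT andP (conj k1 (leqnn k))).
  apply: measurable_mxB; last exact: measurable_grad_f.
  apply: measurable_oracle => //; apply: (@measurable_sample _ (k, i : nat)).
  by split => //= -[] /ord_inj/eqP; apply/negP.
apply: (@le_trans _ _ ((m k)%:R^-1 ^+ 2 * \sum_(j < m k) sigma ^+ 2)).
  by rewrite ler_wpM2l ?sqr_ge0// ler_sum.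
rewrite sumr_const card_ord -mulr_natl le_eqVlt; apply/orP; left; apply/eqP.
by field; rewrite pnatr_eq0 -lt0n.
Qed.

Lemma ydiff_le w j : 0 <= kappa ->
  enorm (ydiff g m (x ^~ w) (fun k i => xi k i w) j) <=
    kappa * enorm (sdiff (x ^~ w) j).
Proof.
move=> kappa0; have [Fdiff gE hk] := AS5.
rewrite /ydiff enormZ ger0_norm ?invr_ge0//.
(* The index [j] is arbitrary, so the batch may be empty; the inverse of 0 is then 0 and [ydiff]
   vanishes. *)
have [->|mj0] := posnP (m j).
  by rewrite invr0 mul0r mulr_ge0 ?enorm_ge0.
rewrite ler_pdivrMl ?ltr0n// mulr_natl; apply: (le_trans (enorm_sum _ _)).
rewrite -[leRHS](_ : \sum_(i < m j) kappa * enorm (sdiff (x ^~ w) j) = _).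
  by apply: ler_sum => i _; rewrite !gE; exact: grad_lipschitz.
by rewrite sumr_const card_ord.
Qed.

Lemma H_opbound k : 0 < kappa ->
  posdef H1 -> loewner_le H1 (kappa_up p kappa delta)%:M ->
  {ae P, forall w, forall j, (1 <= j < N)%N -> sdiff (x ^~ w) j != 0} ->
  (1 <= k <= N)%N -> {ae P, forall w, opbound (H k w) (kappa_up p kappa delta)}.
Proof.
move=> kappa0 [H1t H1pos] H1up sd /andP[]; rewrite leq_eqVlt => /predU1P[<- _|k2 kN].
  apply: nearW => w; have [_ -> _ _] := run w; apply: psd_opbound => //.
  split=> // v; have [->|v0] := eqVneq v 0; last exact: ltW (H1pos v v0).
  by rewrite mulmx0 dot0r.
apply: filterS sd => w sd; have [_ _ HE _] := run w; rewrite HE ?k2//.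
apply: opbound_SdLBFGS => // j jk; split; first by apply: sd; lia.
exact/ydiff_le/ltW.
Qed.

(** Split over the values of [tau]. In each term the gradient is measurable for the sigma-algebra of
    all samples, so decoupling from [tau] factors out the probability of the value. *)
Lemma integral_random_index (tau : {mfun Omega >-> nat}) :
  (forall w, (1 <= tau w <= N)%N) ->
  indep_classes P [set tau @^-1` A | A in setT] (sigma_of (in_batch m N) X) ->
  (\int[P]_w (enorm (grad f (x (tau w) w)) ^+ 2)%:E =
   \sum_(1 <= k < N.+1) P (tau @^-1` [set k]) *
      \int[P]_w (enorm (grad f (x k w)) ^+ 2)%:E)%E.
Proof.
move=> tauN ind.
pose ind_ k (w : Omega) : R := (tau w == k)%:R.
have mnat k : measurable_fun setT (fun t : nat => (t == k)%:R : R) by [].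
have mtau k : measurable_fun setT (ind_ k).
  exact: (measurableT_comp (mnat k) (measurable_funPT tau)).
have split_tau w : (enorm (grad f (x (tau w) w)) ^+ 2)%:E =
    (\sum_(k < N) (enorm (grad f (x k.+1 w)) ^+ 2 * ind_ k.+1 w)%:E)%E.
  have /andP[tau1 tauN'] := tauN w.
  (* The sum over ['I_N] has its iterations shifted by one. *)
  have tauP : ((tau w).-1 < N)%N by lia.
  rewrite (bigD1 (Ordinal tauP))//= prednK// /ind_ eqxx mulr1 big1 ?adde0// => k.
  move=> /eqP ktau; case: eqP => [tk|_]; last by rewrite mulr0.
  by case: ktau; apply: val_inj; rewrite /= tk.
have mgrad (k : 'I_N) : measurable_fun setT (fun w => enorm (grad f (x k.+1 w)) ^+ 2).
  apply: measurable_enorm2; apply: measurable_grad_f.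
  by have [] := @measurable_iterate_Omega k.+1 (introT andP (conj isT (leqW (ltn_ord k)))).
under eq_integral do rewrite split_tau.
rewrite ge0_integral_sum//; last 2 first.
- by move=> k; apply/measurable_EFinP; exact: measurable_funM.
- by move=> k w _; rewrite lee_fin mulr_ge0 ?sqr_ge0.
rewrite big_add1 big_mkord; apply: eq_bigr => k _.
pose G := sample_events (in_batch m N).
have mG : G `<=` measurable by exact: sample_events_measurable.
have [mxk _] := @measurable_iterate (in_batch m N) N.+1 (leqnn _)
  (fun j i jN im => conj jN im) k.+1 (introT andP (conj isT (leqW (ltn_ord k)))).
pose h (z : g_sigma_algebraType G * nat) : \bar R :=
  (enorm (grad f (x k.+1 z.1)) ^+ 2 * (z.2 == k.+1)%:R)%:E.
have mh : measurable_fun [set: g_sigma_algebraType G * nat] h.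
  apply/measurable_EFinP; apply: measurable_funM.
    exact: (measurableT_comp (measurable_enorm2 (measurable_grad_f mxk)) measurable_fst).
  exact: (measurableT_comp (mnat k.+1) measurable_snd).
have indG A B : <<s G >> A -> measurable B ->
    P (A `&` tau @^-1` B) = (P A * P (tau @^-1` B))%E.
  by move=> GA _; rewrite setIC muleC; apply: ind => //; exists B.
transitivity (\int[P]_w h (to_generated G w, tau w))%E; first by [].
rewrite (ge0_decoupling (measurable_to_generated mG) (measurable_funPT tau) indG mh); last first.
  by move=> z; rewrite lee_fin mulr_ge0 ?sqr_ge0.
have mk : measurable (tau @^-1` [set k.+1]) by exact: measurable_funPTI.
have inner w : (\int[P]_w' h (to_generated G w, tau w') =
    P (tau @^-1` [set k.+1]) * (enorm (grad f (x k.+1 w)) ^+ 2)%:E)%E.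
  rewrite /h /=; under eq_integral do rewrite EFinM.
  rewrite ge0_integralZl_EFin ?sqr_ge0//; last first.
    by apply/measurable_EFinP; exact: (mtau k.+1).
  rewrite muleC; congr (_ * _)%E.
  rewrite -[in RHS](setIT (tau @^-1` [set k.+1])) -(integral_indic P measurableT mk).
  apply: eq_integral => w' _; congr EFin; rewrite indicE.
  by case: eqP => [tk|tk]; [rewrite mem_set|rewrite memNset].
under eq_integral do rewrite inner.
apply: ge0_integralZl => //; first exact/measurable_EFinP/mgrad.
by move=> w _; rewrite lee_fin sqr_ge0.
Qed.

Context (klo kup a : R) (mb : nat).
Hypotheses (L_ge0 : 0 <= L) (a_ge0 : 0 <= a) (mb_gt0 : (0 < mb)%N)
  (m_def : forall k, (1 <= k <= N)%N -> m k = mb)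
  (alpha_def : forall k, (1 <= k <= N)%N -> alpha k = a)
  (H_up : forall k, (1 <= k <= N)%N -> {ae P, forall w, opbound (H k w) kup})
  (H_low : forall k, (1 <= k <= N)%N -> {ae P, forall w, loewner_le klo%:M (H k w)}).

Let gradx k w := grad f (x k w).

Let step k : (1 <= k <= N)%N -> forall w,
  x k.+1 w = x k w - a *: (H k w *m (gradx k w + batch_noise k w)).
Proof.
move=> kN w; have [_ _ _ ->//] := run w.
rewrite alpha_def// /batch_noise /gradx; congr (_ - _ *: (_ *m _)).
by rewrite addrC subrK.
Qed.

Let measurable_gradx_other k i : (1 <= k <= N)%N ->
  @measurable_mx _ (g_sigma_algebraType (sample_events (other_samples k i))) R _ _ (gradx k).
Proof.
move=> /andP[k1 kN].
have [mxk _] := @measurable_iterate_other k i k kN (introT andP (conj k1 (leqnn k))).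
exact: measurable_grad_f.
Qed.

Let descent_bound k w := f (x k w) - index_weight klo kup L a * enorm (gradx k w) ^+ 2
    - a * dot ((H k w)^T *m gradx k w) (batch_noise k w)
    + (L * a ^+ 2 * kup ^+ 2) * dot (gradx k w) (batch_noise k w)
    + (L / 2 * a ^+ 2 * kup ^+ 2) * enorm (batch_noise k w) ^+ 2.

Let HTgradx_L2 k : (1 <= k <= N)%N -> L2 P (gradx k) ->
  L2 P (fun w => (H k w)^T *m gradx k w).
Proof.
move=> kN g2; have /andP[k1 kN'] := kN.
have [_ /(_ kN') mH] := @measurable_iterate_Omega k (introT andP (conj k1 (leqW kN'))).
apply: (L2_mulmx (measurable_mx_tr mH) _ g2 (c := kup)).
by apply: filterS (H_up kN) => w; exact: opbound_tr.
Qed.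

Let descent_bound_L1 k : (1 <= k <= N)%N -> L2 P (gradx k) ->
  L1 (fun w => f (x k w)) -> L1 (descent_bound k).
Proof.
move=> kN g2 f1; have mk0 : (0 < m k)%N by rewrite m_def.
have e2 := batch_noise_L2 kN mk0.
apply: L1D; last by apply: L1Z; case: e2.
apply: L1D; last by apply: L1Z; exact: L2_dot.
apply: L1B; last by apply: L1Z; apply: L2_dot => //; exact: HTgradx_L2.
by apply: L1B => //; apply: L1Z; case: g2.
Qed.

Let Ex_descent_bound k : (1 <= k <= N)%N -> L2 P (gradx k) ->
  L1 (fun w => f (x k w)) ->
  Ex (descent_bound k) <= Ex (fun w => f (x k w))
    - index_weight klo kup L a * Ex (fun w => enorm (gradx k w) ^+ 2)
    + (L / 2 * a ^+ 2 * kup ^+ 2) * (sigma ^+ 2 / mb%:R).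
Proof.
move=> kN g2 f1; have mk0 : (0 < m k)%N by rewrite m_def.
have e2 := batch_noise_L2 kN mk0; have Hg2 := HTgradx_L2 kN g2.
have /andP[k1 kN'] := kN.
have orth1 : Ex (fun w => dot ((H k w)^T *m gradx k w) (batch_noise k w)) = 0.
  apply: batch_noise_orthogonal => // i im.
  have [_ mHk] := @measurable_iterate_other k i k kN' (introT andP (conj k1 (leqnn k))).
  by apply: measurable_mxM; [exact: measurable_mx_tr|exact: measurable_gradx_other].
have orth2 : Ex (fun w => dot (gradx k w) (batch_noise k w)) = 0.
  by apply: batch_noise_orthogonal => // i im; exact: measurable_gradx_other.
have i1 := L1Z (index_weight klo kup L a) g2.2.
have i2 := L1Z a (L2_dot Hg2 e2).
have i3 := L1Z (L * a ^+ 2 * kup ^+ 2) (L2_dot g2 e2).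
have i4 := L1Z (L / 2 * a ^+ 2 * kup ^+ 2) e2.2.
have i12 := L1B (L1B f1 i1) i2.
rewrite /descent_bound (RintegralD measurableT (L1D i12 i3) i4).
rewrite (RintegralD measurableT i12 i3) (RintegralB measurableT (L1B f1 i1) i2).
rewrite (RintegralB measurableT f1 i1).
rewrite (RintegralZl _ measurableT g2.2) (RintegralZl _ measurableT (L2_dot Hg2 e2)).
rewrite (RintegralZl _ measurableT (L2_dot g2 e2)) (RintegralZl _ measurableT e2.2).
rewrite orth1 orth2 !mulr0 subr0 addr0 lerD2l.
apply: ler_wpM2l.
  exact: mulr_ge0 (mulr_ge0 (divr_ge0 L_ge0 (ler0n _ _)) (sqr_ge0 _)) (sqr_ge0 _).
by rewrite -(m_def kN); exact: Ex_batch_noise_le.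
Qed.

(** Integrability belongs to the induction: orthogonality to the noise at the next iterate requires
    its gradient to be square-integrable, and taking expectations requires f there to be integrable.
    The latter holds because f lies between [flow] and the integrable [descent_bound]. *)
Lemma expected_descent k : (k <= N)%N ->
  [/\ L2 P (gradx k.+1), L1 (fun w => f (x k.+1 w))
    & Ex (fun w => f (x k.+1 w)) + index_weight klo kup L a *
        \sum_(1 <= j < k.+1) Ex (fun w => enorm (gradx j w) ^+ 2)
      <= f x1 + k%:R * (L / 2 * a ^+ 2 * kup ^+ 2 * (sigma ^+ 2 / mb%:R))].
Proof.
elim: k => [_|k IHk kN].
  have x1E w : x 1%N w = x1 by have [] := run w.
  rewrite /gradx; split.
  - by under eq_fun do rewrite x1E; exact: L2_cst.
  - by under eq_fun do rewrite /= x1E; exact: L1_cst.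
  - under eq_Rintegral do rewrite x1E.
    by rewrite Ex_cst big_geq// mulr0 mul0r.
have [g2 f1 IH] := IHk (ltnW kN).
have k1N : (1 <= k.+1 <= N)%N by [].
have mk0 : (0 < m k.+1)%N by rewrite m_def.
have e2 := batch_noise_L2 k1N mk0.
have [[df _] fl Lf] := AS1.
have [mx _] := @measurable_iterate_Omega k.+2 (introT andP (conj isT kN)).
have desc : {ae P, forall w, f (x k.+2 w) <= descent_bound k.+1 w}.
  apply: filterS2 (H_up k1N) (H_low k1N) => w Aup Alow.
  by rewrite step//; exact: sqn_step_descent AS1 _ _ Aup Alow.
have ib := descent_bound_L1 k1N g2 f1.
have f2 : L1 (fun w => f (x k.+2 w)).
  have ifl : L1 (fun w => `|descent_bound k.+1 w| + `|flow|).
    by apply: L1D; [exact: integrable_abse ib|exact: L1_cst].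
  apply: L1_ae_bound ifl _.
    apply: measurable_continuous_comp => // u.
    exact: differentiable_continuous (df u).
  apply: filterS desc => w fw; rewrite ler_norml; apply/andP; split.
    have := fl (x k.+2 w); have := ler_norm (- flow); rewrite normrN.
    by have := normr_ge0 (descent_bound k.+1 w); lra.
  by have := ler_norm (descent_bound k.+1 w); have := normr_ge0 flow; lra.
split => //.
(* The Lipschitz bound controls the change of the gradient by L a kup |gradient + noise|; |u + v|^2
   <= 2 (|u|^2 + |v|^2) is then used twice. *)
- have ig : L1 (fun w => 2 * (enorm (gradx k.+1 w) ^+ 2 + (L * (a * kup)) ^+ 2 *
      (2 * (enorm (gradx k.+1 w) ^+ 2 + enorm (batch_noise k.+1 w) ^+ 2)))).
    by apply: L1Z; apply: L1D; [exact: g2.2|apply: L1Z; apply: L1Z; apply: L1D;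
      [exact: g2.2|exact: e2.2]].
  apply: (L2_ae_bound (measurable_grad_f mx) ig).
  apply: filterS (H_up k1N) => w Aup.
  have -> : grad f (x k.+2 w) =
      gradx k.+1 w + (grad f (x k.+2 w) - grad f (x k.+1 w)).
    by rewrite /gradx addrC subrK.
  apply: (le_trans (enormD_sqr _ _)); rewrite ler_pM2l// lerD2l.
  apply: (@le_trans _ _ ((L * (a * kup)) ^+ 2 *
      enorm (gradx k.+1 w + batch_noise k.+1 w) ^+ 2)); last first.
    by rewrite ler_wpM2l ?sqr_ge0//; exact: enormD_sqr.
  have bnd : enorm (grad f (x k.+2 w) - grad f (x k.+1 w)) <=
      L * (a * kup) * enorm (gradx k.+1 w + batch_noise k.+1 w).
    apply: (le_trans (Lf _ _)); rewrite step// addrAC subrr add0r enormN enormZ.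
    rewrite ger0_norm// -!mulrA ler_wpM2l// ler_wpM2l//; exact: Aup.
  rewrite -exprMn ler_pXn2r ?nnegrE ?enorm_ge0//.
  exact: le_trans (enorm_ge0 _) bnd.
- have := ae_le_Ex f2 ib desc; have := Ex_descent_bound k1N g2 f1.
  rewrite big_nat_recr//= mulrDr.
  move: IH; set C := L / 2 * a ^+ 2 * kup ^+ 2 * (sigma ^+ 2 / mb%:R).
  have -> : k.+1%:R * C = k%:R * C + C by rewrite -natr1 mulrDl mul1r.
  lra.
Qed.

End Sampling.

(** * Complexity bound *)

Section Complexity.
Context (R : realType).
Implicit Types (klo kup sigma L Dt Df eps : R).

Lemma ceil_nat_itv (r : R) (k : nat) : k%:Z = Num.ceil r -> r <= k%:R < r + 1.
Proof.
move=> kE; have /andP[] := ceil_itv r; rewrite -kE.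
by rewrite intrB -pmulrn ltrBlDr => -> ->.
Qed.

Lemma kappa_low_gt0 (p : nat) (kappa delta : R) :
  0 < kappa -> 0 < delta -> 0 < kappa_low p kappa delta.
Proof.
move=> k0 d0; rewrite /kappa_low invr_gt0; apply: ltr_wpDl.
  by apply: divr_ge0; [apply: mulr_ge0; [exact: mulr_ge0|exact: sqr_ge0]|exact: ltW].
by apply: mulr_gt0; [apply: ltr_wpDl => //; exact: mulr_ge0|exact: addr_gt0].
Qed.

(* AM-GM: [c1 * t <= (c1 ^+ 2 / eps + eps * t ^+ 2) / 2]. *)
Lemma quadratic_rate (c1 c2 eps t : R) : 0 < eps -> 0 < t ->
  c1 ^+ 2 / eps ^+ 2 + 4 * c2 / eps <= t ^+ 2 -> 0 <= c2 ->
  c1 / t + c2 / t ^+ 2 <= eps.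
Proof.
move=> eps0 t0 ht c20.
have -> : c1 / t + c2 / t ^+ 2 = (c1 * t + c2) / t ^+ 2.
  by field; rewrite gt_eqF.
rewrite ler_pdivrMr ?exprn_gt0//.
have : c1 ^+ 2 + 4 * c2 * eps <= t ^+ 2 * eps ^+ 2.
  rewrite -ler_pdivrMr ?exprn_gt0//; apply: le_trans ht.
  by rewrite le_eqVlt; apply/orP; left; apply/eqP; field; rewrite gt_eqF.
move=> h; rewrite -(ler_pM2l eps0).
have := sqr_ge0 (c1 - eps * t).
have : 0 <= c2 * eps by rewrite mulr_ge0// ltW.
by nra.
Qed.

(** With s = sigma t / (L r), the batch size lies between s and 1 + s, so N >= t^2 / (1 + s). The
    first term is then at most K (1 + s) / t^2 and the second at most sigma^2 / s; sorting by powers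
    of 1 / t gives the form required by [quadratic_rate]. *)
Lemma rate_le klo kup sigma L Dt Df eps (Nbar mb N : nat) :
  0 < klo -> 0 < kup -> 0 < sigma -> 0 < L -> 0 < Dt -> 0 <= Df -> 0 < eps ->
  calls_threshold klo kup sigma L Dt Df eps <= Nbar%:R ->
  mb%:Z = Num.ceil (Num.min (Nbar%:R : R)
              (Num.max 1 (sigma / L * Num.sqrt (Nbar%:R / Dt)))) ->
  N%:Z = Num.ceil ((Nbar%:R : R) / mb%:R) ->
  [/\ (0 < mb)%N, (0 < N)%N &
    2 * L * kup ^+ 2 * Df / (N%:R * klo ^+ 2) + sigma ^+ 2 / mb%:R <= eps].
Proof.
move=> klo0 kup0 sigma0 L0 Dt0 Df0 eps0.
rewrite /calls_threshold ge_max => /andP[hC hS] /ceil_nat_itv mbE /ceil_nat_itv NE.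
set Nb : R := Nbar%:R in hC hS mbE NE.
have Nb0 : 0 < Nb.
  by apply: lt_le_trans hS; rewrite divr_gt0 ?mulr_gt0 ?exprn_gt0.
have Nb1 : 1 <= Nb by rewrite ler1n -(ltr0n R).
pose t := Num.sqrt Nb; pose r := Num.sqrt Dt.
have t0 : 0 < t by rewrite sqrtr_gt0.
have r0 : 0 < r by rewrite sqrtr_gt0.
have t2 : t ^+ 2 = Nb by rewrite sqr_sqrtr// ltW.
have r2 : r ^+ 2 = Dt by rewrite sqr_sqrtr// ltW.
pose s := sigma * t / (L * r).
have s0 : 0 < s by rewrite !divr_gt0 ?mulr_gt0.
have sE : sigma / L * Num.sqrt (Nb / Dt) = s.
  rewrite sqrtrM ?ltW// sqrtrV ?ltW// /s -/t -/r.
  by field; rewrite !gt_eqF.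
(* Here the second part of the threshold enters: it makes the minimum with [Nbar] in the batch size
   inactive. *)
have sNb : s <= Nb.
  have st : sigma / (L * r) <= t.
    have Lr0 : 0 < L * r by exact: mulr_gt0.
    rewrite -(@ler_pXn2r _ 2)// ?nnegrE ?(ltW t0) ?divr_ge0 ?(ltW Lr0) ?(ltW sigma0)//.
    by rewrite t2 expr_div_n exprMn r2.
  have -> : s = sigma / (L * r) * t by rewrite /s mulrAC.
  by rewrite -t2 expr2 ler_pM2r.
have minE : Num.min Nb (Num.max 1 s) = Num.max 1 s.
  by apply: min_r; rewrite ge_max Nb1.
move: mbE; rewrite sE minE => /andP[mbge mblt].
have [mb1 mbs] : 1 <= mb%:R :> R /\ s <= mb%:R by move: mbge; rewrite ge_max => /andP.
have mb0 : (0 < mb)%N by rewrite -(ler1n R).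
have mbR0 : 0 < mb%:R :> R by rewrite ltr0n.
(* For s <= 1 the ceiling is exactly 1; otherwise it is below s + 1. *)
have mbs1 : mb%:R <= 1 + s.
  have [s1|s1] := leP s 1.
    have : (mb < 2)%N by rewrite -(ltr_nat R); move: mblt; rewrite max_l//; lra.
    by rewrite ltnS -(ler_nat R); move: s0; lra.
  by move: mblt; rewrite max_r ?(ltW s1)//; lra.
move: NE => /andP[Nge _].
have NR0 : 0 < N%:R :> R by apply: lt_le_trans Nge; rewrite divr_gt0.
have N0 : (0 < N)%N by rewrite -(ltr0n R).
split => //.
have c20 : 0 <= const2 klo kup L Df.
  by rewrite /const2 divr_ge0 ?mulr_ge0 ?sqr_ge0// ?ltW.
apply: le_trans (quadratic_rate eps0 t0 _ c20); last by rewrite t2; exact: hC.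
pose K := 2 * L * kup ^+ 2 * Df / klo ^+ 2.
have K0 : 0 <= K by rewrite /K divr_ge0 ?mulr_ge0 ?sqr_ge0// ?ltW.
have h1 : 2 * L * kup ^+ 2 * Df / (N%:R * klo ^+ 2) <= K * ((1 + s) / t ^+ 2).
  have -> : 2 * L * kup ^+ 2 * Df / (N%:R * klo ^+ 2) = K * N%:R^-1.
    by rewrite /K; field; rewrite !gt_eqF.
  rewrite ler_wpM2l// t2 -[leRHS]invrK lef_pV2 ?posrE// ?invr_gt0 ?divr_gt0 ?addr_gt0//.
  rewrite invf_div; apply: le_trans Nge.
  by rewrite ler_wpM2l ?(ltW Nb0)// lef_pV2 ?posrE// addr_gt0.
have h2 : sigma ^+ 2 / mb%:R <= sigma * L * r / t.
  have -> : sigma * L * r / t = sigma ^+ 2 / s.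
    by rewrite /s; field; rewrite !gt_eqF.
  by rewrite ler_wpM2l ?sqr_ge0// lef_pV2 ?posrE.
apply: (le_trans (lerD h1 h2)).
have -> : K * ((1 + s) / t ^+ 2) + sigma * L * r / t =
    (K * (sigma / (L * r)) + sigma * L * r) / t + K / t ^+ 2.
  by rewrite /s; field; rewrite !gt_eqF.
(* [const2] is twice [K], and the first term of [const1] is likewise twice the coefficient found
   here. *)
have Kc2 : K <= const2 klo kup L Df.
  have -> : const2 klo kup L Df = K + K by rewrite /const2 /K; field; rewrite gt_eqF.
  by rewrite lerDl.
have Kc1 : K * (sigma / (L * r)) + sigma * L * r <= const1 klo kup sigma L Dt Df.
  have -> : const1 klo kup sigma L Dt Df =
      K * (sigma / (L * r)) + K * (sigma / (L * r)) + sigma * L * r.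
    by rewrite /const1 /K -/r; field; rewrite !gt_eqF.
  by rewrite lerD2r lerDl mulr_ge0// divr_ge0 ?mulr_ge0 ?ltW.
apply: lerD.
  by rewrite ler_wpM2r// invr_ge0 ltW.
by rewrite ler_wpM2r// invr_ge0 sqr_ge0.
Qed.

(** The extra calls of iterations 2 to N revisit batches 1 to N - 1, so they amount to the gradient
    calls without the last batch. *)
Lemma sfo_calls_le (m : nat -> nat) (N : nat) :
  (sfo_calls m N <= 2 * grad_calls m N)%N.
Proof.
rewrite /sfo_calls mul2n -addnn leq_add2l /diff_calls /grad_calls.
rewrite big_add1 /=; case: N => [|N]; first by rewrite !big_geq.
by rewrite [leqRHS]big_nat_recr//= leq_addr.
Qed.

Lemma calls_threshold_bigO klo kup sigma L Dt Df :
  0 < klo -> 0 < kup -> 0 < sigma -> 0 < L -> 0 < Dt -> 0 <= Df ->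
  (fun e : R => calls_threshold klo kup sigma L Dt Df e)
    =O_ (0^'+) (fun e : R => (e ^+ 2)^-1).
Proof.
move=> klo0 kup0 sigma0 L0 Dt0 Df0.
pose c1 := const1 klo kup sigma L Dt Df; pose c2 := const2 klo kup L Df.
pose c3 := sigma ^+ 2 / (L ^+ 2 * Dt).
have c20 : 0 <= c2 by rewrite /c2 /const2 divr_ge0 ?mulr_ge0 ?sqr_ge0// ?ltW.
have c30 : 0 < c3 by rewrite /c3 divr_gt0 ?mulr_gt0 ?exprn_gt0.
(* For 0 < e <= 1 both 1 / e and 1 are at most 1 / e^2, so the sum of the coefficients of the three
   terms suffices. *)
apply/eqO_exP; exists (c1 ^+ 2 + 4 * c2 + c3).
  by rewrite ltr_wpDl// addr_ge0 ?sqr_ge0// mulr_ge0.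
near=> e.
have e0 : 0 < e by near: e; exact: nbhs_right_gt.
have e1 : e <= 1 by near: e; exact: nbhs_right_le.
have e20 : 0 < e ^+ 2 by rewrite exprn_gt0.
have e21 : e ^+ 2 <= 1 by rewrite exprn_ile1// ltW.
rewrite ger0_norm; last first.
  by rewrite /calls_threshold le_max (ltW c30) orbT.
rewrite ger0_norm ?invr_ge0 ?(ltW e20)// /calls_threshold -/c1 -/c2 -/c3 ge_max.
apply/andP; split; rewrite ler_pdivlMr//.
  have -> : (c1 ^+ 2 / e ^+ 2 + 4 * c2 / e) * e ^+ 2 = c1 ^+ 2 + 4 * c2 * e.
    by field; rewrite gt_eqF.
  have : c2 * e <= c2 by rewrite ler_piMr.
  by move: c30; lra.
have : c3 * e ^+ 2 <= c3 by rewrite ler_piMr// ltW.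
by have := sqr_ge0 c1; lra.
Unshelve. all: by end_near. Qed.

End Complexity.

Theorem theorem3p1 (R : realType) (d : measure_display)
  (Omega : measurableType d) (P : probability Omega R) (n q : nat)
  (F : 'cV[R]_n -> 'cV[R]_q -> R) (g : 'cV[R]_n -> 'cV[R]_q -> 'cV[R]_n)
  (f : 'cV[R]_n -> R) (xi0 : Omega -> 'cV[R]_q)
  (F_borel : borel_fun (fun xz : 'cV[R]_n * 'cV[R]_q => F xz.1 xz.2))
  (xi0_rv : random_element xi0)
  (f_mean : forall x, P.-integrable setT (fun w => (F x (xi0 w))%:E) /\
     'E_P[fun w => F x (xi0 w)]%E = (f x)%:E)
  (flow L sigma kappa delta Dt eps : R)
  (L_gt0 : 0 < L) (sigma_gt0 : 0 < sigma) (kappa_gt0 : 0 < kappa)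
  (delta_gt0 : 0 < delta) (Dt_gt0 : 0 < Dt) (eps_gt0 : 0 < eps)
  (p : nat) (p_ge1 : (1 <= p)%N)
  (Nbar mb N : nat) (m : nat -> nat) (alpha : nat -> R)
  (x1 : 'cV[R]_n) (H1 : 'M[R]_n)
  (xi : nat -> nat -> Omega -> 'cV[R]_q)
  (x : nat -> Omega -> 'cV[R]_n) (H : nat -> Omega -> 'M[R]_n)
  (tau : {mfun Omega >-> nat})
  (klo := kappa_low p kappa delta) (kup := kappa_up p kappa delta)
  (Df := f x1 - flow)
  (Nbar_large : calls_threshold klo kup sigma L Dt Df eps <= Nbar%:R)
  (mb_def : mb%:Z = Num.ceil (Num.min (Nbar%:R : R)
              (Num.max 1 (sigma / L * Num.sqrt (Nbar%:R / Dt)))))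
  (N_def : N%:Z = Num.ceil ((Nbar%:R : R) / mb%:R))
  (m_def : forall k, (1 <= k <= N)%N -> m k = mb)
  (alpha_def : forall k, (1 <= k <= N)%N -> alpha k = klo / (L * kup ^+ 2))
  (xi_rv : forall k i, (1 <= k <= N)%N -> (i < m k)%N ->
     random_element (xi k i))
  (H1_pd : posdef H1)
  (H1_low : loewner_le klo%:M H1) (H1_up : loewner_le H1 kup%:M)
  (run : forall w, sqn_run g m alpha delta p x1 H1 N
     (fun k i => xi k i w) (x ^~ w) (H ^~ w))
  (well_defined : {ae P, forall w, forall j, (1 <= j < N)%N ->
     sdiff (x ^~ w) j != 0 /\
     dot (sdiff (x ^~ w) j) (ydiff g m (x ^~ w) (fun k i => xi k i w) j) != 0})
  (* The upper bound kup on H k follows from the other hypotheses; the lower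
     bound klo does not when the Hessians of F are indefinite, because the
     ratio (y^T y) / (s^T y) is then unbounded. *)
  (H_low : {ae P, forall w, forall k, (2 <= k <= N)%N ->
     loewner_le klo%:M (H k w)})
  (AS1 : smooth_objective f flow L)
  (AS2 : stochastic_oracle P f g sigma m N x xi)
  (AS5 : smooth_samples F g kappa)
  (tau_range : forall w, (1 <= tau w <= N)%N)
  (tau_law : forall k, (1 <= k <= N)%N ->
     P (tau @^-1` [set k])
     = (index_weight klo kup L (alpha k)
        / \sum_(1 <= j < N.+1) index_weight klo kup L (alpha j))%:E)
  (tau_indep : indep_classes P [set tau @^-1` A | A in setT]
     (sigma_of (in_batch m N) (fun ki => xi ki.1 ki.2))) :
  [/\ ('E_P[fun w => (enorm (grad f (x (tau w) w)) ^+ 2)%R] <= eps%:E)%E,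
      (* The antecedent says that Nbar is the number of oracle calls used to
         calculate the stochastic gradients, that is, that mb divides Nbar. *)
      Nbar = grad_calls m N ->
        (sfo_calls m N <= 2 * Nbar)%N
    & (fun e : R => calls_threshold klo kup sigma L Dt Df e)
        =O_ (0^'+) (fun e : R => (e ^+ 2)^-1)].
Proof.
have klo0 : 0 < klo by exact: kappa_low_gt0.
have kup0 : 0 < kup by exact: kappa_up_gt0.
have Df0 : 0 <= Df by have [_ fl _] := AS1; rewrite subr_ge0.
have [mb0 N0 rate] :=
  rate_le klo0 kup0 sigma_gt0 L_gt0 Dt_gt0 Df0 eps_gt0 Nbar_large mb_def N_def.
split; last exact: calls_threshold_bigO; last first.
  by move=> NbarE; rewrite [in leqRHS]NbarE; exact: sfo_calls_le.
pose a := klo / (L * kup ^+ 2).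
have a0 : 0 <= a by rewrite divr_ge0 ?mulr_ge0 ?sqr_ge0// ltW.
have Hup k : (1 <= k <= N)%N -> {ae P, forall w, opbound (H k w) kup}.
  apply: (H_opbound delta_gt0 run AS5 kappa_gt0 H1_pd H1_up).
  by apply: filterS well_defined => w wd j /wd[].
have Hlow k : (1 <= k <= N)%N -> {ae P, forall w, loewner_le klo%:M (H k w)}.
  move=> /andP[]; rewrite leq_eqVlt => /predU1P[<- _|k2 kN].
    by apply: nearW => w; have [_ -> _ _] := run w.
  by apply: filterS H_low => w; apply; rewrite k2.
pose wt := index_weight klo kup L a.
have wtE : wt = klo ^+ 2 / (2 * L * kup ^+ 2).
  by rewrite /wt /index_weight /a; field; rewrite !gt_eqF.
have wt0 : 0 < wt by rewrite wtE divr_gt0 ?mulr_gt0 ?exprn_gt0.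
(* The step size maximizes [index_weight], and there the coefficient of the variance equals the
   weight; dividing by [wt] leaves exactly sigma^2 / mb per iteration. *)
have varE : L / 2 * a ^+ 2 * kup ^+ 2 = wt.
  by rewrite wtE /a; field; rewrite !gt_eqF.
have ED k (kN : (k <= N)%N) := expected_descent F_borel delta_gt0 xi_rv run AS1 AS2
  AS5 (ltW L_gt0) a0 mb0 m_def alpha_def Hup Hlow kN.
pose E k := Rintegral P setT (fun w => enorm (grad f (x k w)) ^+ 2).
have sumE : wt * \sum_(1 <= k < N.+1) E k <= Df + N%:R * (wt * (sigma ^+ 2 / mb%:R)).
  have [_ if1 bnd] := ED N (leqnn N).
  have flowE : flow <= Rintegral P setT (fun w => f (x N.+1 w)).
    rewrite -[leLHS](Ex_cst P); apply: ae_le_Ex => //; first exact: L1_cst.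
    by have [_ fl _] := AS1; apply: nearW => w; exact: fl.
  move: bnd; rewrite varE -/wt /Df; move: flowE; rewrite /E.
  lra.
(* Constant step sizes make all weights equal, so the random index is uniform. *)
have lawE k : (1 <= k <= N)%N -> P (tau @^-1` [set k]) = (N%:R^-1)%:E.
  move=> kN; rewrite tau_law//; congr EFin.
  rewrite (eq_big_nat _ _ (F2 := fun=> wt)) => [|j jN]; last by rewrite alpha_def.
  rewrite sumr_const_nat subn1 /= alpha_def// -/a -/wt -mulr_natl.
  by field; rewrite pnatr_eq0 -lt0n N0 gt_eqF.
rewrite expectation.unlock (integral_random_index F_borel delta_gt0 xi_rv run AS1 AS5)//.
have -> : (\sum_(1 <= k < N.+1) P (tau @^-1` [set k]) *
    \int[P]_w (enorm (grad f (x k w)) ^+ 2)%:E =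
    (N%:R^-1 * \sum_(1 <= k < N.+1) E k)%:E)%E.
  rewrite mulr_sumr -sumEFin; apply: eq_big_nat => -[//|k] kN.
  rewrite lawE// EFinM; congr (_ * _)%E; rewrite /E /Rintegral fineK//.
  have [[_ ig] _ _] := ED k (ltnW kN).
  exact: integrable_fin_num ig.
rewrite lee_fin; apply: le_trans rate.
have NR0 : 0 < N%:R :> R by rewrite ltr0n.
rewrite -(ler_pM2l wt0) mulrCA ler_pdivrMl//; apply: (le_trans sumE).
rewrite le_eqVlt; apply/orP; left; apply/eqP.
have mbR0 : 0 < mb%:R :> R by rewrite ltr0n.
by rewrite wtE; field; rewrite !gt_eqF.
Qed.
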